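(* Let $X$ be a homotopically trivial non-contractible topological space such that $\#X=9$. Then $X$ is homeomorphic to either the space $P$ or its opposite $P^{\mathrm{op}}$, where $P$ is the finite T$_0$-space associated to the poset on the nine-element set $\{a_1,a_2,a_3,b_1,b_2,b_3,c_1,c_2,c_3\}$ whose covering relations are exactly $$b_1<a_1,\quad b_2<a_1,\quad b_1<a_2,\quad b_3<a_2,\quad b_2<a_3,\quad b_3<a_3,$$ $$c_1<b_1,\quad c_1<b_2,\quad c_2<b_1,\quad c_2<b_2,\quad c_2<b_3,\quad c_3<b_2,\quad c_3<b_3$$ (the order of $P$ being the reflexive transitive closure of these relations).
   Context: $\#X$ denotes the cardinality of the underlying set of $X$. A topological space is homotopically trivial (weakly contractible) if it is non-empty, path-connected and all its homotopy groups are trivial. Contractible means homotopy equivalent to a point. Finite T$_0$-spaces correspond to finite posets: for a point $x$ of a finite T$_0$-space, $U_x$ denotes the intersection of all open sets containing $x$, and $x_1\leq x_2$ if and only if $U_{x_1}\subseteq U_{x_2}$. Conversely, the finite T$_0$-space associated to a finite poset has as open sets exactly the down-closed subsets. The opposite $P^{\mathrm{op}}$ of a finite T$_0$-space $P$ is the finite T$_0$-space associated to the same set with the inverse order. *)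

(* Defs.v *)
From HB Require Import structures.
From mathcomp Require Import all_boot all_order all_algebra.
From mathcomp Require Import all_classical all_reals all_analysis.
Import Order.TTheory GRing.Theory Num.Theory.
Import numFieldNormedType.Exports.

Set Implicit Arguments.
Unset Strict Implicit.
Unset Printing Implicit Defensive.

Local Open Scope classical_set_scope.
Local Open Scope ring_scope.

Definition homeomorphic (X Y : topologicalType) : Prop :=
  exists (f : X -> Y) (g : Y -> X),
    [/\ continuous f, continuous g, cancel f g & cancel g f].

Section homotopy.
Variable R : realType.

(* Maps on a subspace A are represented by total functions considered on A
   only; their values outside A are irrelevant. *)
Definition homotopic_rel (S X : topologicalType) (A B : set S)
    (f g : S -> X) : Prop :=
  exists H : S * R -> X,
    [/\ {within A `*` `[0, 1], continuous H},
        (forall s, A s -> H (s, 0) = f s),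
        (forall s, A s -> H (s, 1) = g s) &
        (forall s t, B s -> t \in `[0, 1] -> H (s, t) = f s)].

Definition homotopic (X Y : topologicalType) (f g : X -> Y) : Prop :=
  homotopic_rel [set: X] set0 f g.

Definition homotopy_equivalent (X Y : topologicalType) : Prop :=
  exists (f : X -> Y) (g : Y -> X),
    [/\ continuous f, continuous g,
        homotopic (g \o f) idfun & homotopic (f \o g) idfun].

Definition contractible (X : topologicalType) : Prop :=
  homotopy_equivalent X (discrete_topology unit).

Definition path_connected (X : topologicalType) : Prop :=
  forall x y : X, exists p : R -> X,
    [/\ {within `[0, 1], continuous p}, p 0 = x & p 1 = y].

Definition cube n : set 'rV[R]_n := [set s | forall i, s 0 i \in `[0, 1]].

Definition cube_boundary n : set 'rV[R]_n :=
  [set s | cube s /\ exists i, s 0 i = 0 \/ s 0 i = 1].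

Definition based_cube_map (X : topologicalType) n (x : X) :
    set ('rV[R]_n -> X) :=
  [set f | {within @cube n, continuous f} /\
           forall s, cube_boundary s -> f s = x].

Definition homotopy_class (X : topologicalType) n (x : X)
    (f : 'rV[R]_n -> X) : set ('rV[R]_n -> X) :=
  [set g | based_cube_map x g /\
           homotopic_rel (@cube n) (@cube_boundary n) f g].

(* The underlying set of the n-th homotopy group of X at x (for n >= 1); its
   neutral element is the class of the constant map, so that the group is
   trivial when this set is reduced to that class. *)
Definition homotopy_group (X : topologicalType) n (x : X) :
    set (set ('rV[R]_n -> X)) :=
  [set homotopy_class x f | f in based_cube_map x].

Definition homotopically_trivial (X : topologicalType) : Prop :=
  [/\ [set: X] !=set0,
      path_connected X &
      forall (n : nat) (x : X),
        @homotopy_group X n.+1 x = [set homotopy_class x (cst x)]].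

End homotopy.

Definition poset_space {d} (T : finPOrderType d) : Type := T.

Section poset_space.
Context {d} (T : finPOrderType d).

Definition down_closed : set_system (poset_space T) :=
  [set A | forall x y : T, (x <= y)%O -> A y -> A x].

Local Lemma down_closedT : down_closed setT. Proof. by []. Qed.

Local Lemma down_closedI (A B : set (poset_space T)) :
  down_closed A -> down_closed B -> down_closed (A `&` B).
Proof.
by move=> dA dB x y xy [Ay By]; split; [exact: dA xy Ay | exact: dB xy By].
Qed.

Local Lemma down_closed_bigU (I : Type) (f : I -> set (poset_space T)) :
  (forall i, down_closed (f i)) -> down_closed (\bigcup_i f i).
Proof. by move=> df x y xy [i _ fy]; exists i => //; exact: df xy fy. Qed.

HB.instance Definition _ := Choice.copy (poset_space T) T.
HB.instance Definition _ := isOpenTopological.Build (poset_space T)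
  down_closedT down_closedI down_closed_bigU.

Lemma poset_space_openE (A : set (poset_space T)) : open A = down_closed A.
Proof. by []. Qed.

End poset_space.

Inductive P_pt := a1 | a2 | a3 | b1 | b2 | b3 | c1 | c2 | c3.

Definition P_enum := [:: a1; a2; a3; b1; b2; b3; c1; c2; c3].

Definition P_code (x : P_pt) : nat :=
  match x with
  | a1 => 0 | a2 => 1 | a3 => 2 | b1 => 3 | b2 => 4 | b3 => 5
  | c1 => 6 | c2 => 7 | c3 => 8
  end%N.

Lemma P_codeK : cancel P_code (nth a1 P_enum). Proof. by case. Qed.

HB.instance Definition _ := Countable.copy P_pt (can_type P_codeK).

Lemma P_enumP : Finite.axiom P_enum. Proof. by case. Qed.

HB.instance Definition _ := fintype.isFinite.Build P_pt P_enumP.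

Definition P_cover (x y : P_pt) : bool :=
  match x, y with
  | b1, a1 | b2, a1 | b1, a2 | b3, a2 | b2, a3 | b3, a3
  | c1, b1 | c1, b2 | c2, b1 | c2, b2 | c2, b3 | c3, b2 | c3, b3 => true
  | _, _ => false
  end.

Definition P_le : rel P_pt := connect P_cover.

Lemma P_cover_code x y : P_cover x y -> (P_code y < P_code x)%N.
Proof. by case: x; case: y. Qed.

Lemma P_le_code x y : P_le x y -> x = y \/ (P_code y < P_code x)%N.
Proof.
case/connectP => p; elim: p x => [|z p IHp] x /= => [_ ->|/andP[xz zp] yE].
  by left.
right; have yz : (P_code y <= P_code z)%N.
  by case: (IHp z zp yE) => [->//|/ltnW].
exact: leq_ltn_trans yz (P_cover_code xz).
Qed.

Lemma P_le_refl : reflexive P_le. Proof. exact: connect0. Qed.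

Lemma P_le_anti : antisymmetric P_le.
Proof.
move=> x y /andP[/P_le_code[//|yx] /P_le_code[//|xy]].
by have := ltn_trans yx xy; rewrite ltnn.
Qed.

Lemma P_le_trans : transitive P_le. Proof. exact: connect_trans. Qed.

Fact P_display : Order.disp_t. Proof. exact: Order.Disp tt tt. Qed.

HB.instance Definition _ := Order.Le_isPOrder.Build P_display P_pt
  P_le_refl P_le_anti P_le_trans.

Definition P : topologicalType := poset_space P_pt.
Definition Pop : topologicalType := poset_space P_pt^d.

(* Main.v *)
(* Among the subspaces X_0 of X such that some retraction of X to X_0 is
   homotopic to the identity, take one with the fewest points. Then X_0 is a
   finite poset without beat points, and it has at least two points since X is
   not contractible. The order complex K of X_0 is acyclic mod 2: weak
   contractibility of X yields a null homotopy of the map from K to X taking a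
   point to the largest vertex of maximal weight; composing it with the
   retraction, and labelling the cells of a fine cubical subdivision of
   K x [0, T] by points of X_0 monotonically with respect to faces, one obtains
   that every mod 2 cocycle vanishes on every mod 2 cycle. It remains to
   enumerate the posets with 2 to 9 points and without beat points: each of them
   but P and its dual carries an explicit cocycle and an explicit cycle with
   non-zero pairing. Hence X_0 has nine points, so that X = X_0. *)

Require Import Defs.
From mathcomp Require Import all_boot all_order all_algebra.
From mathcomp Require Import all_classical all_reals all_analysis.
From mathcomp Require Import zify lra.
Import Order.TTheory GRing.Theory Num.Theory.
Import numFieldNormedType.Exports.

Set Implicit Arguments.
Unset Strict Implicit.
Unset Printing Implicit Defensive.

(** * Order complexes and the cubical grid *)

(** Homology of [X] itself never appears: acyclicity speaks of lists of chains of the core, and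
    topology enters only through one continuous map [G] from the complex times a time ray to [X].
    The link is that labels which grow towards faces turn each flag of grid cells into a weakly
    decreasing list, so that a cocycle pulls back to the grid. At time 0 this pull-back has degree
    one on every simplex, at the end all labels coincide, and consecutive time slices agree because
    the chain is a cycle. The obstacle is the choice of labels: distinct values of [G] need not have
    disjoint neighbourhoods, so the usual Lebesgue number argument is replaced by one on sets [Nb]
    whose labels are comparable whenever the sets come close. Realizing the complex by points with
    largest coordinate 1 in a cube, rather than by barycentric coordinates, is what makes a regular
    cubical grid fit it. Coefficients mod 2 spare all signs, and they detect every competing
    poset. *)

Notation "\xor_ ( i <- r ) F" := (\big[addb/false]_(i <- r) F)
  (at level 41, F at level 41, i, r at level 50, format "\xor_ ( i  <-  r )  F").

Lemma xor_const (I : Type) (r : seq I) (b : bool) : \xor_(i <- r) b = odd (size r) && b.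
Proof.
elim: r => [|i r]; first by rewrite big_nil.
by rewrite big_cons => -> /=; case: odd; case: b.
Qed.

Lemma xor_add (I : Type) (r : seq I) (F G : I -> bool) :
  \xor_(i <- r) (F i (+) G i) = (\xor_(i <- r) F i) (+) (\xor_(i <- r) G i).
Proof. exact: big_split. Qed.

Lemma xor0 (I : Type) (r : seq I) : \xor_(i <- r) false = false.
Proof. by rewrite xor_const andbF. Qed.

Lemma xor_andl (I : Type) (r : seq I) (b : bool) (F : I -> bool) :
  \xor_(i <- r) (b && F i) = b && \xor_(i <- r) F i.
Proof. by case: b => //=; rewrite xor0. Qed.

Lemma xor_odd_count (I : Type) (r : seq I) (F : pred I) : \xor_(i <- r) F i = odd (count F r).
Proof. by elim: r => [|i r IH]; rewrite ?big_nil // big_cons IH /= oddD oddb. Qed.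

Lemma xor_pairs (I J K : Type) (f : I -> J -> K) (r : seq I) (s : seq J) (F : K -> bool) :
  \xor_(x <- [seq f i j | i <- r, j <- s]) F x = \xor_(i <- r) \xor_(j <- s) F (f i j).
Proof.
elim: r => [|i r IH] /=; first by rewrite !big_nil.
by rewrite big_cat big_map big_cons IH.
Qed.

(** * Mod 2 chains and cochains of a finite order *)

Section Faces.
Variable T : Type.
Implicit Types s t : seq T.

Fixpoint faces s : seq (seq T) :=
  if s is x :: s' then s' :: map (cons x) (faces s') else [::].

Lemma size_faces s : size (faces s) = size s.
Proof. by elim: s => //= x s IH; rewrite size_map IH. Qed.

End Faces.

Lemma map_faces (T U : Type) (f : T -> U) s : map (map f) (faces s) = faces (map f s).
Proof.
elim: s => //= x s IH; congr (_ :: _); rewrite -IH -!map_comp.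
by apply: eq_map.
Qed.

Lemma mem_faces (T : eqType) (s t : seq T) :
  t \in faces s -> subseq t s /\ size s = (size t).+1.
Proof.
elim: s t => //= x s IH t; rewrite inE => /predU1P[->|/mapP[u us ->]].
  by split=> //; exact: subseq_cons.
by have [us' /= ->] := IH _ us; rewrite eqxx.
Qed.

Lemma faces_rem (T : eqType) (s : seq T) : uniq s -> faces s = [seq rem x s | x <- s].
Proof.
elim: s => //= x s IH /andP[xs us]; rewrite eqxx IH // -map_comp; congr (_ :: _).
apply/eq_in_map => y ys /=; case: eqP => // xy; by rewrite xy ys in xs.
Qed.

Section Acyclic.
Variables (T : eqType) (lt : rel T).

Definition rgt : rel T := fun x y => lt y x.

(** Chains are strictly decreasing lists; the values of [phi] on other lists are arbitrary, whence
    [normalize] below. *)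
Definition cocycle n (phi : pred (seq T)) :=
  forall s, size s = n.+2 -> sorted rgt s -> \xor_(t <- faces s) phi t = false.

(** Testing the boundary against every [h] expresses that it is zero mod 2. The only face of a
    one-element list is [[::]], so degree 0 is reduced: a 0-cycle has an even number of points. *)
Definition chain_cycle n (z : seq (seq T)) :=
  all (fun s => sorted rgt s && (size s == n.+1)) z /\
  forall h : pred (seq T), \xor_(s <- z) \xor_(t <- faces s) h t = false.

(** Over a field, a homology class on which all cocycles vanish is zero; so this is the vanishing of
    reduced homology mod 2. *)
Definition acyclic := forall n phi z, cocycle n phi -> chain_cycle n z -> \xor_(s <- z) phi s = false.

Hypotheses (lt_irr : irreflexive lt) (lt_trans : transitive lt).

Definition rge : rel T := fun x y => (x == y) || rgt x y.

Lemma gt_trans : transitive rgt.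
Proof. by move=> y x z; rewrite /rgt => yx zy; exact: lt_trans zy yx. Qed.

Definition normalize (phi : pred (seq T)) : pred (seq T) := fun s => sorted rgt s && phi s.

Lemma sorted_gtE s t : sorted rgt (s ++ t) -> sorted rgt t.
Proof. exact: subseq_sorted gt_trans _ _ (suffix_subseq s t). Qed.

(** Deleting either of two equal neighbours gives the same list, so these two faces cancel; every
    other face keeps the repetition and is killed by [normalize]. The prefix [p] serves the
    induction. *)
Lemma normalize_degenerate phi p s : sorted rge s -> ~~ sorted rgt s ->
  \xor_(t <- faces s) normalize phi (p ++ t) = false.
Proof.
elim: s p => //= x s IH p ps; rewrite big_cons big_map.
have [gs|ngs] := boolP (sorted rgt s); last first.
  rewrite {1}/normalize; case: (boolP (sorted rgt (p ++ s))) => [/sorted_gtE|_].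
    by rewrite (negPf ngs).
  rewrite addFb; under eq_bigr do rewrite -cat_rcons.
  by rewrite IH // (path_sorted ps).
case: s ps gs {IH} => //= y s /andP[xy ps] gs; rewrite gs andbT => ngxy.
move: xy; rewrite /rge (negPf ngxy) orbF => /eqP xy; subst y.
rewrite big_cons big_map addbA addbb addFb big1 // => t _.
rewrite /normalize; case: (boolP (sorted _ _)) => //= /sorted_gtE /=.
by rewrite /rgt lt_irr.
Qed.

Lemma normalize_cocycle n phi s : cocycle n phi -> size s = n.+2 -> sorted rge s ->
  \xor_(t <- faces s) normalize phi t = false.
Proof.
move=> cphi ss gs; have [sgt|nsgt] := boolP (sorted rgt s); last exact: (normalize_degenerate phi [::]).
rewrite -[RHS](cphi _ ss sgt); apply: eq_big_seq => t /mem_faces[ts _].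
by rewrite /normalize (subseq_sorted gt_trans ts sgt).
Qed.

End Acyclic.

(* A cell of the cubical grid is its list of coordinate codes: the even code
   2k stands for the point k, the odd code 2k+1 for the interval ]k, k+1[. *)
Fixpoint facets (C : seq nat) : seq (seq nat) :=
  if C is a :: C' then
    map (cons a) (facets C') ++ (if odd a then [:: a.-1 :: C'; a.+1 :: C'] else [::])
  else [::].

Lemma xor_facets_cons (h : seq nat -> bool) a C :
  \xor_(F <- facets (a :: C)) h F =
  (\xor_(F <- facets C) h (a :: F)) (+) (odd a && (h (a.-1 :: C) (+) h (a.+1 :: C))).
Proof.
rewrite /= big_cat big_map; case: (odd a) => /=; last by rewrite big_nil.
by rewrite !big_cons big_nil addbF.
Qed.

Lemma facets_even C b : \xor_(F <- facets C) b = false.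
Proof.
elim: C => [|a C IH]; first by rewrite big_nil.
by rewrite xor_facets_cons IH addbb andbF.
Qed.

Lemma facets_facets h C : \xor_(F <- facets C) \xor_(G <- facets F) h G = false.
Proof.
elim: C h => [|a C IH] h; first by rewrite big_nil.
rewrite xor_facets_cons; under eq_bigr do rewrite xor_facets_cons.
rewrite xor_add IH addFb xor_andl xor_add.
case: (boolP (odd a)) => //= oa; rewrite !xor_facets_cons /= oa.
have -> : odd a.-1 = false by case: a oa => //= a /negPf.
by rewrite !addbF addbb.
Qed.

Lemma size_facets C F : F \in facets C -> size F = size C.
Proof.
elim: C F => //= a C IH F; rewrite mem_cat => /orP[/mapP[G /IH <- ->] //|].
by case: (odd a) => //; rewrite !inE => /orP[] /eqP ->.
Qed.

Lemma facets_nth C F : F \in facets C ->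
  exists j, [/\ j < size C, odd (nth 0 C j),
    (nth 0 F j = (nth 0 C j).-1) \/ (nth 0 F j = (nth 0 C j).+1) &
    forall i, i != j -> nth 0 F i = nth 0 C i].
Proof.
elim: C F => //= a C IH F; rewrite mem_cat => /orP[/mapP[G /IH[j [jC oj Gj Gi]] ->]|].
  by exists j.+1; split=> //= -[|i] //=; rewrite eqSS; exact: Gi.
case: ifP => // oa; rewrite !inE => /orP[] /eqP ->; exists 0; split=> //=;
  [by left| by case|by right|by case].
Qed.

(** * Pulling cochains back to the grid along a labelling *)

Section Labels.
Variables (T : eqType) (lt : rel T) (lab : seq nat -> T).
Hypotheses (lt_irr : irreflexive lt) (lt_trans : transitive lt).
Notation ge := (rge lt).

(* Sum of psi over the label lists of all complete flags of faces of C, the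
   label of the smallest face coming first. *)
Fixpoint flagsum (psi : pred (seq T)) k C s : bool :=
  if k is k'.+1 then \xor_(F <- facets C) flagsum psi k' F (lab C :: s)
  else psi (lab C :: s).

Lemma flagsum_eq (Q : seq nat -> Prop) (R : pred T) psi psi' k C s :
  (forall C F, Q C -> F \in facets C -> Q F /\ ge (lab F) (lab C)) ->
  (forall C, Q C -> R (lab C)) ->
  (forall l, size l = k.+1 + size s -> sorted ge l -> all R l -> psi l = psi' l) ->
  Q C -> all R s -> sorted ge (lab C :: s) ->
  flagsum psi k C s = flagsum psi' k C s.
Proof.
move=> QF QR; elim: k C s => [|k IH] C s eqpsi QC Rs gs /=.
  by apply: eqpsi => //=; rewrite QR.
apply: eq_big_seq => F FC; have [QF' geF] := QF _ _ QC FC; apply: IH => //.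
- by move=> l ll; apply: eqpsi; rewrite ll /= addnS.
- by rewrite /= QR.
- by rewrite /= geF.
Qed.

Lemma eq_flagsum psi psi' k C s : psi =1 psi' -> flagsum psi k C s = flagsum psi' k C s.
Proof. by move=> e; elim: k C s => /= [|k IH] C s; [exact: e | apply: eq_bigr]. Qed.

Lemma flagsum0 k C s : flagsum (fun _ => false) k C s = false.
Proof. by elim: k C s => //= k IH C s; under eq_bigr do rewrite IH; rewrite xor0. Qed.

Lemma flagsum_add psi psi' k C s :
  flagsum (fun l => psi l (+) psi' l) k C s = flagsum psi k C s (+) flagsum psi' k C s.
Proof. by elim: k C s => //= k IH C s; under eq_bigr do rewrite IH; exact: xor_add. Qed.

Lemma flagsum_andl b psi k C s :
  flagsum (fun l => b && psi l) k C s = b && flagsum psi k C s.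
Proof. by case: b => //=; exact: flagsum0. Qed.

Definition drop1 i (l : seq T) := take i l ++ drop i.+1 l.

Lemma faces_drop1 l : faces l = [seq drop1 i l | i <- iota 0 (size l)].
Proof.
elim: l => //= x l IH; rewrite /drop1 /= drop0; congr (_ :: _).
by rewrite IH -map_comp -(add1n 0) iotaDl -map_comp; apply: eq_map.
Qed.

Lemma flagsum_drop psi k C a s :
  flagsum (fun l => psi (drop1 k.+1 l)) k C (a :: s) = flagsum psi k C s.
Proof.
suff H : forall k C t, flagsum (fun l => psi (drop1 (k.+1 + size t) l)) k C (t ++ a :: s) =
   flagsum psi k C (t ++ s) by have := H k C [::]; rewrite addn0.
elim=> [|k' IH] D t /=.
  rewrite /drop1 add1n /= take_cat ltnn subnn take0 cats0 drop_cat ltnNge leqnSn /= subSnn /=.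
  by rewrite drop0.
apply: eq_bigr => F _; rewrite -(IH F (lab D :: t)) /=.
by rewrite addnS.
Qed.

(** Only the first [k.+1] entries are deleted: the others are the labels [s] collected before the
    flag, which occur only in the induction. *)
Definition cobord k (psi : pred (seq T)) (l : seq T) := \xor_(i <- iota 0 k.+1) psi (drop1 i l).

(* All faces of a flag but its top one cancel in pairs, because d o d = 0. *)
Lemma flagsum_cobord psi k C s :
  flagsum (cobord k.+1 psi) k.+1 C s = \xor_(F <- facets C) flagsum psi k F s.
Proof.
elim: k C s => [|k IH] C s.
  rewrite /=; under eq_bigr do rewrite /cobord !big_cons big_nil addbF /drop1 /= drop0.
  by rewrite xor_add facets_even addFb.
transitivity (\xor_(F <- facets C) flagsum (cobord k.+2 psi) k.+1 F (lab C :: s)) => //.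
transitivity (\xor_(F <- facets C) ((\xor_(G <- facets F) flagsum psi k G (lab C :: s)) (+)
   flagsum psi k.+1 F s)); last by rewrite xor_add facets_facets addFb.
apply: eq_bigr => F _; rewrite -IH -(flagsum_drop psi k.+1 F (lab C) s) -flagsum_add; apply: eq_flagsum => l.
by rewrite /cobord -[in LHS](addn1 k.+2) iotaD big_cat big_seq1.
Qed.

(** Labels growing on facets make flags weakly decreasing lists, where a normalized cocycle is still
    closed: its pull-back is a cubical cocycle. *)
Lemma flagsum_facets (Q : seq nat -> Prop) n phi C :
  (forall C F, Q C -> F \in facets C -> Q F /\ ge (lab F) (lab C)) ->
  cocycle lt n phi -> Q C ->
  \xor_(F <- facets C) flagsum (normalize lt phi) n F [::] = false.
Proof.
move=> Qf cphi QC; rewrite -flagsum_cobord -(flagsum0 n.+1 C [::]).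
apply: (@flagsum_eq Q predT) => // l; rewrite addn0 => ll gl _.
by rewrite /cobord -(big_map (drop1^~ l) predT) -ll -faces_drop1 (normalize_cocycle _ _ cphi).
Qed.

End Labels.

(** * Cubical subdivision of a simplex and its boundary *)

Section Cells.
Variable N : nat.

Definition odds := [seq k.*2.+1 | k <- iota 0 N].

(* cellsA mu subdivides the cube [0, N]^mu, and cellsB mu the part of its
   boundary on which some coordinate equals N: a copy of the simplex mu. *)
Fixpoint cellsA (mu : seq bool) : seq (seq nat) :=
  if mu is b :: mu' then
    if b then [seq a :: C | a <- odds, C <- cellsA mu'] else map (cons 0) (cellsA mu')
  else [:: [::]].

Fixpoint cellsB (mu : seq bool) : seq (seq nat) :=
  if mu is b :: mu' then
    if b then [seq a :: C | a <- odds, C <- cellsB mu'] ++ map (cons N.*2) (cellsA mu')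
    else map (cons 0) (cellsB mu')
  else [::].

Fixpoint unset1s (mu : seq bool) : seq (seq bool) :=
  if mu is b :: mu' then
    (if b then [:: false :: mu'] else [::]) ++ map (cons b) (unset1s mu')
  else [::].

Lemma odds_telescope (g : nat -> bool) :
  \xor_(a <- odds) (g a.-1 (+) g a.+1) = g 0 (+) g N.*2.
Proof.
rewrite big_map; elim: N => [|k IH]; first by rewrite big_nil addbb.
rewrite -[in LHS](addn1 k) iotaD big_cat big_seq1 IH /= add0n -doubleS.
by rewrite addbA -(addbA (g 0)) addbb addbF.
Qed.

Lemma odds_odd a : a \in odds -> odd a.
Proof. by case/mapP => k _ ->; rewrite /= odd_double. Qed.

Lemma mem_odds a : (a \in odds) = odd a && (a < N.*2).
Proof.
apply/mapP/andP => [[k]|[oa aN]].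
  by rewrite mem_iota add0n => /= kN ->; rewrite /= odd_double -doubleS leq_double.
exists a./2; last by rewrite -[LHS]odd_double_half oa.
by rewrite mem_iota /= add0n -ltn_double (leq_ltn_trans _ aN) // -[leqRHS]odd_double_half leq_addl.
Qed.

Lemma odds_uniq : uniq odds.
Proof. by rewrite map_inj_uniq ?iota_uniq // => i j [/double_inj]. Qed.

Lemma xor_unset1s_cons (F : seq bool -> bool) b mu :
  \xor_(nu <- unset1s (b :: mu)) F nu =
  (b && F (false :: mu)) (+) \xor_(nu <- unset1s mu) F (b :: nu).
Proof. by rewrite /= big_cat big_map; case: b; rewrite ?big_seq1 ?big_nil. Qed.

Lemma unset1s_unset1s (F : seq bool -> bool) mu :
  \xor_(nu <- unset1s mu) \xor_(nu' <- unset1s nu) F nu' = false.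
Proof.
elim: mu F => [|b mu IH] F; first by rewrite big_nil.
rewrite xor_unset1s_cons; under [X in _ (+) X]eq_bigr do rewrite xor_unset1s_cons.
by rewrite xor_add IH addbF xor_unset1s_cons /= -xor_andl addbb.
Qed.

Lemma cellsA_cons (h : seq nat -> bool) b mu :
  \xor_(C <- cellsA (b :: mu)) h C =
  if b then \xor_(a <- odds) \xor_(C <- cellsA mu) h (a :: C) else \xor_(C <- cellsA mu) h (0 :: C).
Proof. by case: b => /=; rewrite ?xor_pairs ?big_map. Qed.

Lemma cellsB_cons (h : seq nat -> bool) b mu :
  \xor_(C <- cellsB (b :: mu)) h C =
  if b then (\xor_(a <- odds) \xor_(C <- cellsB mu) h (a :: C)) (+) \xor_(C <- cellsA mu) h (N.*2 :: C)
  else \xor_(C <- cellsB mu) h (0 :: C).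
Proof. by case: b => /=; rewrite ?big_cat ?xor_pairs ?big_map. Qed.

(** Inner facets occur twice and cancel. There remain the sides where a coordinate is [N], and those
    where one is 0, which are the cubes of the faces of the simplex. *)
Lemma facets_cellsA (h : seq nat -> bool) mu :
  \xor_(C <- cellsA mu) \xor_(F <- facets C) h F =
  (\xor_(C <- cellsB mu) h C) (+) \xor_(nu <- unset1s mu) \xor_(C <- cellsA nu) h C.
Proof.
elim: mu h => [|b mu IH] h; first by rewrite big_seq1 !big_nil.
rewrite cellsA_cons cellsB_cons xor_unset1s_cons; case: b => /=; last first.
  under eq_bigr do rewrite xor_facets_cons addbF.
  by rewrite IH; under [X in _ (+) X = _]eq_bigr do rewrite -(big_map (cons 0) xpredT).
transitivity (\xor_(a <- odds) (\xor_(C <- cellsA mu) \xor_(F <- facets C) h (a :: F)) (+)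
   \xor_(a <- odds) ((\xor_(C <- cellsA mu) h (a.-1 :: C)) (+) (\xor_(C <- cellsA mu) h (a.+1 :: C)))).
  rewrite -xor_add; apply: eq_big_seq => a /odds_odd oa; rewrite -!xor_add.
  by apply: eq_bigr => C _; rewrite xor_facets_cons oa.
rewrite (odds_telescope (fun a => \xor_(C <- cellsA mu) h (a :: C))) big_map.
under eq_bigr do rewrite IH.
rewrite xor_add; under [X in _ = _ (+) (_ (+) X)]eq_bigr do rewrite xor_pairs.
rewrite [X in _ = _ (+) (_ (+) X)]exchange_big /=.
rewrite -!addbA; congr (_ (+) _); rewrite addbCA addbC -addbA [in LHS]addbC -!addbA.
by congr (_ (+) _); rewrite addbC.
Qed.

(** Obtained by taking boundaries in [facets_cellsA]: the double boundary vanishes, and so does the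
    sum over vertices deleted twice. Thus [cellsB] is a chain map from simplices to the grid. *)
Lemma facets_cellsB (h : seq nat -> bool) mu :
  \xor_(C <- cellsB mu) \xor_(F <- facets C) h F =
  \xor_(nu <- unset1s mu) \xor_(C <- cellsB nu) h C.
Proof.
have := facets_cellsA (fun C => \xor_(F <- facets C) h F) mu.
under eq_bigr do rewrite facets_facets.
under [X in _ = _ (+) X]eq_bigr do rewrite facets_cellsA.
rewrite xor0 xor_add unset1s_unset1s addbF => /esym.
by case: (\xor_(C <- cellsB mu) _); case: (\xor_(nu <- _) _).
Qed.

End Cells.

Lemma xor_eq_mem (T : eqType) (s : seq T) x : uniq s -> \xor_(y <- s) (y == x) = (x \in s).
Proof. by move=> us; rewrite xor_odd_count (count_uniq_mem x us) oddb. Qed.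

Lemma xor_facets_nth h C :
  \xor_(F <- facets C) h F =
  \xor_(j <- iota 0 (size C)) (odd (nth 0 C j) &&
    (h (set_nth 0 C j (nth 0 C j).-1) (+) h (set_nth 0 C j (nth 0 C j).+1))).
Proof.
elim: C h => [|a C IH] h; first by rewrite !big_nil.
rewrite xor_facets_cons /= big_cons IH -(add1n 0) iotaDl big_map [RHS]addbC; congr (_ (+) _).
Qed.

(** * The labelling by largest full vertices has degree one *)

Section Support.
Variables (m N : nat).
Hypothesis N_gt0 : 0 < N.

Lemma xor_cellsA_cons C b mu a :
  \xor_(D <- cellsA N (b :: mu)) (D == a :: C) =
  (if b then a \in odds N else a == 0) && \xor_(D <- cellsA N mu) (D == C).
Proof.
rewrite cellsA_cons; case: b; last first.
  by under eq_bigr do rewrite eqseq_cons eq_sym; rewrite xor_andl.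
transitivity (\xor_(a' <- odds N) ((\xor_(D <- cellsA N mu) (D == C)) && (a' == a))).
  by apply: eq_bigr => a' _; under eq_bigr do rewrite eqseq_cons; rewrite xor_andl andbC.
by rewrite xor_andl (xor_eq_mem a (odds_uniq N)) andbC.
Qed.

Lemma xor_cellsB_cons C b mu a :
  \xor_(D <- cellsB N (b :: mu)) (D == a :: C) =
  ((if b then a \in odds N else a == 0) && \xor_(D <- cellsB N mu) (D == C)) (+)
  (b && (a == N.*2) && \xor_(D <- cellsA N mu) (D == C)).
Proof.
rewrite cellsB_cons; case: b; last first.
  by under eq_bigr do rewrite eqseq_cons eq_sym; rewrite xor_andl addbF.
rewrite andTb [a == _]eq_sym; congr (_ (+) _); last first.
  by under eq_bigr do rewrite eqseq_cons; rewrite xor_andl.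
transitivity (\xor_(a' <- odds N) ((\xor_(D <- cellsB N mu) (D == C)) && (a' == a))).
  by apply: eq_bigr => a' _; under eq_bigr do rewrite eqseq_cons; rewrite xor_andl andbC.
by rewrite xor_andl (xor_eq_mem a (odds_uniq N)) andbC.
Qed.

Lemma double_notin_odds : N.*2 \in odds N = false.
Proof. by rewrite mem_odds odd_double. Qed.

Section Functions.
Variables (I : eqType) (p : pred I) (c : I -> nat).
Let ok i := if p i then c i \in odds N else c i == 0.

Lemma xor_cellsA_map s :
  all ok s -> \xor_(D <- cellsA N (map p s)) (D == map c s) = true.
Proof.
elim: s => [|i s IH]; first by rewrite big_seq1.
by case/andP=> oki oks; rewrite map_cons xor_cellsA_cons [map _ _]/= IH // andbT.
Qed.

Lemma xor_cellsB_map s x : uniq s -> p x -> c x = N.*2 ->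
  all (fun i => (i == x) || ok i) s ->
  \xor_(D <- cellsB N (map p s)) (D == map c s) = (x \in s).
Proof.
move=> us px cx; elim: s us => [|i s IH] /=; first by rewrite big_nil.
move=> /andP[is_ us] /andP[oki oks]; rewrite xor_cellsB_cons IH // inE.
have [ix|nix] := eqVneq i x.
  rewrite ix in is_ *; rewrite px cx double_notin_odds eqxx /= xor_cellsA_map //.
  apply/allP => j js; have := allP oks j js.
  by case: eqP => // jx; rewrite -jx js in is_.
move: oki; rewrite (negPf nix) /= /ok => oki; rewrite oki /=.
case: (p i) oki => //=; last by rewrite addbF.
by case: eqP => [->|]; rewrite ?double_notin_odds // addbF.
Qed.

End Functions.

Lemma cellsA_nth mu C : C \in cellsA N mu -> size C = size mu /\
  forall j, nth 0 C j <= N.*2 /\ (nth 0 C j != 0) = nth false mu j.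
Proof.
elim: mu C => [|b mu IH] C /=; first by rewrite inE => /eqP ->; split=> // j; rewrite !nth_nil.
case: b => [/allpairsP[[a D] /= [ao /IH[<- H] ->]]|/mapP[D /IH[<- H] ->]]; split=> // -[|j] //=.
by move: ao; rewrite mem_odds => /andP[oa /ltnW ->]; split=> //; case: a oa.
Qed.

Lemma cellsB_nth mu C : C \in cellsB N mu -> [/\ size C = size mu,
  (forall j, nth 0 C j <= N.*2 /\ (nth 0 C j != 0) = nth false mu j) &
  exists2 j, j < size mu & nth 0 C j = N.*2].
Proof.
elim: mu C => [|b mu IH] C //=.
case: b => [|/mapP[D /IH[<- H [j js Hj]] ->]]; last first.
  by split=> // [[|i] //=|]; exists j.+1.
rewrite mem_cat => /orP[/allpairsP[[a D] /= [ao /IH[<- H [j js Hj]] ->]]|/mapP[D /cellsA_nth[<- H] ->]].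
  split=> // [[|i] //=|]; last by exists j.+1.
  by move: ao; rewrite mem_odds => /andP[oa /ltnW ->]; split=> //; case: a oa.
split=> // [[|i] //=|]; last by exists 0.
by rewrite leqnn; split=> //; rewrite -lt0n double_gt0.
Qed.

Definition msk (s : seq 'I_m) : seq bool := [seq i \in s | i <- enum 'I_m].

Lemma nth_msk s (i : 'I_m) : nth false (msk s) i = (i \in s).
Proof. by rewrite (nth_map i) ?size_enum_ord // nth_ord_enum. Qed.

Lemma xor_unset1s (I : eqType) (p : pred I) (s : seq I) (F : seq bool -> bool) : uniq s ->
  \xor_(nu <- unset1s (map p s)) F nu = \xor_(i <- seq.filter p s) F (map (predD1 p i) s).
Proof.
elim: s F => [|x s IH] F; first by rewrite !big_nil.
move=> /= /andP[xs us]; rewrite xor_unset1s_cons IH //.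
have eqx : map (predD1 p x) s = map p s.
  by apply/eq_in_map => i is_ /=; case: eqP => // ix; rewrite -ix is_ in xs.
have -> : \xor_(i <- seq.filter p s) F (p x :: map (predD1 p i) s) =
          \xor_(i <- seq.filter p s) F (map (predD1 p i) (x :: s)).
  apply: eq_big_seq => i; rewrite mem_filter /= => /andP[_ is_].
  by case: eqP => // xi; rewrite xi is_ in xs.
by rewrite /=; case: (p x); rewrite /= ?big_cons /= ?eqxx ?eqx.
Qed.

Lemma xor_unset1s_msk (s : seq 'I_m) (F : seq bool -> bool) : uniq s ->
  \xor_(nu <- unset1s (msk s)) F nu = \xor_(t <- faces s) F (msk t).
Proof.
move=> us; rewrite (@xor_unset1s _ (mem s)) ?enum_uniq // faces_rem // big_map.
rewrite (perm_big s); last first.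
  apply: uniq_perm => //; first by rewrite filter_uniq ?enum_uniq.
  by move=> i; rewrite mem_filter mem_enum andbT.
apply: eq_bigr => i _; congr F; apply: eq_map => j /=.
by rewrite mem_rem_uniq.
Qed.

Section Order.
Variable lt : rel 'I_m.
Hypotheses (lt_irr : irreflexive lt) (lt_trans : transitive lt).
Notation ge := (rge lt).
Notation gt := (rgt lt).

(** Grid cells of the order complex scaled by [N]; the code [N.*2] stands for the coordinate [N]. *)
Definition in_complex (C : seq nat) := [/\ size C = m,
  (forall i : 'I_m, nth 0 C i <= N.*2),
  (exists i : 'I_m, nth 0 C i = N.*2) &
  forall i j : 'I_m, nth 0 C i != 0 -> nth 0 C j != 0 -> ge i j \/ ge j i].

Lemma facets_double C F j : F \in facets C -> nth 0 C j = N.*2 -> nth 0 F j = N.*2.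
Proof.
move=> /facets_nth[i [iC oi Fi Fj]] CN; rewrite Fj //; apply: contraTneq oi => <-.
by rewrite CN odd_double.
Qed.

Lemma facets_supp C F j : F \in facets C -> nth 0 F j != 0 -> nth 0 C j != 0.
Proof.
move=> /facets_nth[i [iC oi Fi Fj]]; have [-> _|/Fj ->//] := eqVneq j i.
by case: (nth 0 C i) oi.
Qed.

Lemma facets_in_complex C F : in_complex C -> F \in facets C -> in_complex F.
Proof.
move=> [sC CN [i Ci] Cc] FC; split.
- by rewrite (size_facets FC).
- move=> j; have [k [kC ok Fk Fj]] := facets_nth FC.
  have [jk|/Fj ->//] := eqVneq (j : nat) k.
  have := CN j; rewrite jk leq_eqVlt => /predU1P[CkN|CkN].
    by rewrite CkN odd_double in ok.
  by case: Fk => -> //; rewrite (leq_trans (leq_pred _)) // ltnW.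
- by exists i; exact: facets_double FC Ci.
- by move=> a b /(facets_supp FC) ? /(facets_supp FC) ?; exact: Cc.
Qed.

Section Bottom.
Variable lab : seq nat -> 'I_m.
Hypothesis lab_top : forall C, in_complex C ->
  nth 0 C (lab C) = N.*2 /\ forall i : 'I_m, nth 0 C i = N.*2 -> ge (lab C) i.

Lemma facets_lab C F : in_complex C -> F \in facets C -> ge (lab F) (lab C).
Proof.
move=> KC FC; have [_] := lab_top (facets_in_complex KC FC); apply.
by apply: facets_double FC _; case: (lab_top KC).
Qed.

Section Simplex.
Variables (n : nat) (sg : seq 'I_m) (x0 : 'I_m).
Hypotheses (size_sg : size sg = n.+1) (sg_sorted : sorted gt sg).
Notation sgi := (nth x0 sg).

Let Q C := in_complex C /\ forall i : 'I_m, nth 0 C i != 0 -> i \in sg.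

Let Qfacets C F : Q C -> F \in facets C -> Q F /\ ge (lab F) (lab C).
Proof.
move=> [KC sC] FC; split; last exact: facets_lab.
by split=> [|i /(facets_supp FC)]; [exact: facets_in_complex FC | exact: sC].
Qed.

Let N2 : N.*2 != 0. Proof. by rewrite -lt0n double_gt0. Qed.

Let Qlab C : Q C -> lab C \in sg.
Proof. by move=> [KC]; apply; have [-> _] := lab_top KC. Qed.

Let gt_tr : transitive gt := gt_trans lt_trans.
Let gt_irr : irreflexive gt. Proof. by move=> x; rewrite /rgt lt_irr. Qed.

Let sgi_gt i j : i < j -> j <= n -> gt (sgi i) (sgi j).
Proof.
move=> ij jn; apply: (sorted_ltn_nth gt_tr) => //; rewrite inE size_sg ltnS //.
by rewrite (leq_trans (ltnW ij)).
Qed.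

Let sgi_inj i j : i <= n -> j <= n -> sgi i = sgi j -> i = j.
Proof.
move=> i_n jn e; case: (ltngtP i j) => // [ij|ji].
  by have := sgi_gt ij jn; rewrite e gt_irr.
by have := sgi_gt ji i_n; rewrite e gt_irr.
Qed.

Lemma flagsum_pred1_tail k C s : s != drop k.+1 sg -> flagsum lab (pred1 sg) k C s = false.
Proof.
elim: k C s => [|k IH] C s /= ns.
  by apply: contra_neqF ns => /eqP <-; rewrite /= drop0.
apply: big1 => F _; apply: IH; apply: contraNneq ns => e.
by rewrite -[in drop _ _]addn1 addnC -drop_drop -e /= drop0.
Qed.

(** For a flag to spell [sg], each step down to a facet has to push the next larger vertex of [sg]
    from the last interval below [N] to [N], since a label is the largest vertex at [N]. *)
Lemma flagsum_simplex k C : k <= n -> Q C ->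
  flagsum lab (pred1 sg) k C (drop k.+1 sg) =
  (nth 0 C (sgi k) == N.*2) && all (fun i => nth 0 C (sgi i) == N.*2.-1) (iota 0 k).
Proof.
elim: k C => [|k IH] C kn QC.
  rewrite /= andbT; have [KC sC] := QC; have [lC lmax] := lab_top KC.
  have -> : (lab C :: drop 1 sg == sg) = (lab C == sgi 0).
    by case: sg size_sg => //= x s _; rewrite drop0 eqseq_cons eqxx andbT.
  apply/eqP/eqP => [<- //|/lmax]; rewrite /rge => /orP[/eqP//|].
  have /(nthP x0)[i i_n <-] := Qlab QC.
  case: i i_n => // i; rewrite size_sg => i_n /(gt_tr (sgi_gt (isT : 0 < i.+1) i_n)).
  by rewrite gt_irr.
have [KC sC] := QC; have [lC lmax] := lab_top KC.
have [labC|nlabC] := eqVneq (lab C) (sgi k.+1); last first.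
  have -> : flagsum lab (pred1 sg) k.+1 C (drop k.+2 sg) = false.
    apply: big1 => F FC; apply: flagsum_pred1_tail.
    by rewrite [drop k.+1 _](drop_nth x0) ?size_sg // eqseq_cons (negPf nlabC).
  apply/esym; apply: contra_neqF nlabC => /andP[/eqP/lmax].
  rewrite /rge => /orP[/eqP//|gtl] /allP H; exfalso.
  have /(nthP x0)[i] := Qlab QC; rewrite size_sg ltnS => i_n li.
  have ik : i < k.+1.
    rewrite ltnNge leq_eqVlt; apply/negP => /predU1P[ki|ki].
      by move: gtl; rewrite -li -ki gt_irr.
    by have := gt_tr gtl (sgi_gt ki i_n); rewrite li gt_irr.
  have := H i; rewrite mem_iota add0n => /(_ ik); rewrite li lC => /eqP e.
  by have := N2; rewrite -lt0n -ltn_predL -e ltnn.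
have sgk : nth 0 C (sgi k) != N.*2.
  apply: contraTneq isT => /lmax; rewrite labC /rge => /orP[/eqP e|].
    by have := sgi_inj kn (ltnW kn) e => /eqP; rewrite eqn_leq ltnn.
  by move/(gt_tr (sgi_gt (ltnSn k) kn)); rewrite gt_irr.
have -> : flagsum lab (pred1 sg) k.+1 C (drop k.+2 sg) =
   \xor_(F <- facets C) flagsum lab (pred1 sg) k F (drop k.+1 sg).
  by rewrite /= labC -(drop_nth x0) ?size_sg.
rewrite -labC lC eqxx andTb -[in iota 0 k.+1](addn1 k) iotaD all_cat /= add0n andbT andbC.
set A := all _ _.
rewrite (eq_big_seq (fun F => (nth 0 F (sgi k) == N.*2) &&
   all (fun i => nth 0 F (sgi i) == N.*2.-1) (iota 0 k))); last first.
  by move=> F FC /=; apply: IH; [exact: ltnW | case: (Qfacets QC FC)].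
have sC' : size C = m by case: KC.
(* Coordinate [sgi k] is not at [N] in [C], so the only facet that can count is the one moving it
   there from [N.*2.-1]. *)
rewrite xor_facets_nth.
transitivity (\xor_(j <- iota 0 (size C)) ((nth 0 C (sgi k) == N.*2.-1) && A && (j == sgi k))).
  apply: eq_bigr => j _; rewrite !nth_set_nth /= ![sgi k == j :> nat]eq_sym.
  have [->|njk] := eqVneq j (sgi k); last by rewrite (negPf sgk) /= andbF andbF.
  rewrite andbT; have bound := let: And4 _ b _ _ := KC in b (sgi k).
  have [->|nk] := eqVneq (nth 0 C (sgi k)) N.*2.-1; last first.
    rewrite andFb; case: eqP => [e|_].
      by move: bound; rewrite leqNgt -e; case: (nth 0 C (sgi k)) sgk e => [|a] //= ; rewrite ltnSn.
    case: eqP => [e|_]; last by rewrite andbF.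
    by move: nk; rewrite -e eqxx.
  rewrite andTb prednK ?lt0n // eqxx andTb.
  have -> : odd N.*2.-1 by rewrite -[odd _]negbK -oddS prednK ?lt0n // odd_double.
  have -> : (N.*2.-1.-1 == N.*2) = false.
    by apply/negbTE; rewrite neq_ltn (leq_ltn_trans (leq_pred _)) // ltn_predL lt0n.
  rewrite andTb addFb; apply: eq_in_all => i; rewrite mem_iota add0n => /andP[_ ik].
  rewrite nth_set_nth /=; case: (nat_of_ord (sgi i) =P nat_of_ord (sgi k)) => [/ord_inj e|_ //]; have := ik.
  by rewrite (sgi_inj _ _ e) ?ltnn // ?(ltnW kn) // (leq_trans (ltnW ik)) // ltnW.
rewrite xor_andl xor_eq_mem ?iota_uniq // mem_iota add0n leq0n sC' ltn_ord andbT.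
by rewrite andbT.
Qed.

(** Labels of cells of this simplex lie in [sg], so the only strictly decreasing label list of full
    length is [sg] itself, and only one cell has a flag that spells it. *)
Lemma flagsum_cellsB phi : \xor_(C <- cellsB N (msk sg)) flagsum lab (normalize lt phi) n C [::] = phi sg.
Proof.
have us : uniq sg by apply: sorted_uniq sg_sorted.
have QB C : C \in cellsB N (msk sg) -> Q C.
  move/cellsB_nth => [sC H [j jm Cj]]; rewrite size_map size_enum_ord in sC jm.
  have supp (i : 'I_m) : nth 0 C i != 0 -> i \in sg by case: (H i) => _ ->; rewrite nth_msk.
  split=> //; split=> //; first by move=> i; case: (H i).
    by exists (Ordinal jm).
  move=> a b /supp/(nthP x0)[i]; rewrite size_sg ltnS => i_n <- /supp/(nthP x0)[k].
  rewrite size_sg ltnS => k_n <-; rewrite /rge.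
  by case: (ltngtP i k) => [/sgi_gt->|/sgi_gt->|->]; rewrite ?orbT ?eqxx; auto.
have -> : \xor_(C <- cellsB N (msk sg)) flagsum lab (normalize lt phi) n C [::] =
  phi sg && \xor_(C <- cellsB N (msk sg)) flagsum lab (pred1 sg) n C (drop n.+1 sg).
  rewrite -xor_andl; apply: eq_big_seq => C /QB QC; rewrite drop_oversize ?size_sg //.
  rewrite -flagsum_andl; apply: (@flagsum_eq _ _ _ Q (mem sg)) => //.
    by move=> D F; exact: Qfacets.
  move=> l.
  rewrite addn0 => sl _ lsg; rewrite /normalize /=.
  have [->|nl] := eqVneq l sg; first by rewrite sg_sorted andbT.
  rewrite andbF; apply: contra_neqF nl => /andP[gl _].
  apply: (irr_sorted_eq gt_tr gt_irr) => // i.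
  have ul : uniq l by apply: sorted_uniq gl.
  by have [_ ->] := uniq_min_size ul (allP lsg) ltac:(by rewrite size_sg sl).
rewrite -[RHS]andbT; congr (_ && _).
(* That cell: the least vertex of [sg] at [N], the others in the last interval before it. *)
pose c (i : 'I_m) := if i \in sg then (if i == sgi n then N.*2 else N.*2.-1) else 0.
rewrite -[RHS](mem_enum 'I_m (sgi n)).
have sgn : sgi n \in sg by rewrite mem_nth ?size_sg.
rewrite -(@xor_cellsB_map _ (mem sg) c); first last.
- apply/allP => i _; rewrite /c /=; case: eqP => //= _; case: (i \in sg) => //.
  by rewrite mem_odds -[odd _]negbK -oddS prednK ?lt0n // odd_double leqnn.
- by rewrite /c sgn eqxx.
- by [].
- exact: enum_uniq.
apply: eq_big_seq => C CB; have QC := QB _ CB; rewrite flagsum_simplex //.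
have [sC H _] := cellsB_nth CB; rewrite size_map size_enum_ord in sC.
apply/andP/eqP => [[/eqP Cn /allP Ci]|->].
  apply: (@eq_from_nth _ 0); first by rewrite size_map size_enum_ord.
  rewrite sC => j jm; have -> : j = Ordinal jm by [].
  rewrite (nth_map (Ordinal jm)) ?size_enum_ord // nth_ord_enum /c.
  case: ifPn => [/(nthP x0)[i]|js]; last first.
    by apply/eqP; apply: contraNT js; case: (H (Ordinal jm)) => _ ->; rewrite nth_msk.
  rewrite size_sg ltnS => i_n <-; case: eqP => [->//|]; move: i_n; rewrite leq_eqVlt => /predU1P[->//|i_n _].
  by apply/eqP/Ci; rewrite mem_iota.
have cE (i : 'I_m) : nth 0 (map c (enum 'I_m)) i = c i.
  by rewrite (nth_map i) ?size_enum_ord // nth_ord_enum.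
split; first by rewrite cE /c sgn eqxx.
apply/allP => i; rewrite mem_iota add0n => /andP[_ i_n]; rewrite cE /c mem_nth ?size_sg ?ltnS 1?ltnW //.
have [e|_] := sgi i =P sgi n; last by rewrite eqxx.
by move: (i_n); rewrite (sgi_inj (ltnW i_n) (leqnn n) e) ltnn.
Qed.

End Simplex.
End Bottom.
End Order.
End Support.

(** * Invariance of the pairing along the time axis *)

Section Prism.
Variables (m N L : nat) (lt : rel 'I_m) (lab : nat -> seq nat -> 'I_m) (x0 : 'I_m).
Hypotheses (N_gt0 : 0 < N) (lt_irr : irreflexive lt) (lt_trans : transitive lt).
Notation ge := (rge lt).
Notation in_complex := (in_complex N lt).
Hypothesis lab_bottom : forall C, in_complex C ->
  nth 0 C (lab 0 C) = N.*2 /\ forall i : 'I_m, nth 0 C i = N.*2 -> ge (lab 0 C) i.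
Hypothesis lab_facets : forall t C F, t <= L.*2 -> in_complex C -> F \in facets C ->
  ge (lab t F) (lab t C).
Hypothesis lab_time : forall t C, odd t -> t < L.*2 -> in_complex C ->
  ge (lab t.-1 C) (lab t C) /\ ge (lab t.+1 C) (lab t C).
Hypothesis lab_top : forall C, in_complex C -> lab L.*2 C = x0.

Let labt C := lab (head 0 C) (behead C).

Let Q C := head 0 C <= L.*2 /\ in_complex (behead C).

Lemma flagsum_even psi t k C s : ~~ odd t ->
  flagsum labt psi k (t :: C) s = flagsum (lab t) psi k C s.
Proof.
move=> ot; elim: k C s => //= k IH C s; rewrite (negPf ot) cats0 big_map.
by apply: eq_bigr => F _; exact: IH.
Qed.

Lemma Qfacets C F : Q C -> F \in facets C -> Q F /\ ge (labt F) (labt C).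
Proof.
case: C => [|t C] // [/= tL KC]; rewrite mem_cat => /orP[/mapP[G GC ->]|].
  by split; [split=> //=; exact: facets_in_complex GC | exact: lab_facets].
case: ifP => // ot; have tL' : t < L.*2.
  by rewrite ltn_neqAle tL andbT; apply: contraTneq ot => ->; rewrite odd_double.
have [g1 g2] := lab_time ot tL' KC.
by rewrite !inE => /orP[] /eqP ->; split=> //; split=> //=; rewrite (leq_trans (leq_pred _)) // ltnW.
Qed.

Variables (n : nat) (phi : pred (seq 'I_m)) (z : seq (seq 'I_m)).
Hypotheses (cphi : cocycle lt n phi) (cz : chain_cycle lt n z).

Let z_sorted s : s \in z -> sorted (rgt lt) s /\ size s = n.+1.
Proof. by case: cz => /allP H _ /H/andP[? /eqP]. Qed.

Let z_uniq s : s \in z -> uniq s.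
Proof.
case/z_sorted => + _; apply: sorted_uniq; first exact: gt_trans.
by move=> x; rewrite /rgt lt_irr.
Qed.

Let in_complex_cellsB s C : s \in z -> C \in cellsB N (msk s) -> in_complex C.
Proof.
move=> /z_sorted[ss zs] /(cellsB_nth N_gt0)[sC H [j jm Cj]].
rewrite size_map size_enum_ord in sC jm.
have supp (i : 'I_m) : nth 0 C i != 0 -> i \in s by case: (H i) => _ ->; rewrite nth_msk.
split=> //; first by move=> i; case: (H i).
  by exists (Ordinal jm).
move=> a b /supp a_s /supp b_s; case: (ltngtP (index a s) (index b s)) => [ab|ba|].
- left; apply/orP; right; rewrite -(nth_index a a_s) -[X in rgt _ _ X](nth_index a b_s).
  by apply: (sorted_ltn_nth (gt_trans lt_trans)) ss _ _ _ _ _; rewrite ?inE ?index_mem.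
- right; apply/orP; right; rewrite -(nth_index a b_s) -[X in rgt _ _ X](nth_index a a_s).
  by apply: (sorted_ltn_nth (gt_trans lt_trans)) ss _ _ _ _ _; rewrite ?inE ?index_mem.
- by move/index_inj => ->; rewrite // /rge eqxx; left.
Qed.

Definition slice t := \xor_(s <- z) \xor_(C <- cellsB N (msk s))
  flagsum labt (normalize lt phi) n (t :: C) [::].

Lemma slice_bottom : slice 0 = \xor_(s <- z) phi s.
Proof.
apply: eq_big_seq => s zs; have [ss sz] := z_sorted zs.
rewrite -(flagsum_cellsB N_gt0 lt_irr lt_trans lab_bottom x0 sz ss).
by apply: eq_bigr => C _; exact: flagsum_even.
Qed.

(** The pulled back cocycle vanishes on the boundary of the prism over one time interval. The
    lateral facets cancel since [z] is a cycle and [cellsB] a chain map; the two ends are the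
    slices. *)
Lemma slice_step j : j < L -> slice j.*2 = slice j.*2.+2.
Proof.
move=> jL; have : slice j.*2 (+) slice j.*2.+2 = false; last by case: slice; case: slice.
set h := flagsum labt (normalize lt phi) n ^~ [::].
have : \xor_(s <- z) \xor_(C <- cellsB N (msk s)) \xor_(F <- facets C) h (j.*2.+1 :: F) = false.
  under eq_bigr do rewrite facets_cellsB.
  rewrite -[RHS](let: conj _ H := cz in H (fun t => \xor_(C <- cellsB N (msk t)) h (j.*2.+1 :: C))).
  apply: eq_big_seq => s zs; exact: (xor_unset1s_msk _ (z_uniq zs)).
move=> H; rewrite -[LHS]addFb -{1}H /slice -!xor_add; apply: big1_seq => s /= zs.
rewrite -!xor_add; apply: big1_seq => C /= CB.
transitivity (\xor_(F <- facets (j.*2.+1 :: C)) h F).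
  by rewrite xor_facets_cons /= odd_double.
apply: (flagsum_facets lt_irr lt_trans Qfacets cphi).
by split=> /=; [rewrite ltn_double | exact: in_complex_cellsB CB].
Qed.

(** In positive degree the constant label lists are degenerate. In degree 0 every point of [z]
    contributes [phi [:: x0]], and there is an even number of them. *)
Lemma slice_top : slice L.*2 = false.
Proof.
have [n0|n_gt0] := posnP n; last first.
  apply: big1_seq => s /= zs; apply: big1_seq => C /= CB.
  rewrite flagsum_even ?odd_double // -(flagsum0 (lab L.*2) n C [::]).
  apply: (@flagsum_eq _ lt _ in_complex (pred1 x0)) => //.
  - by move=> D F KD FD; split; [exact: facets_in_complex FD | exact: lab_facets].
  - by move=> D KD /=; rewrite lab_top.
  - move=> l; rewrite addn0 => sl _; case: l sl n_gt0 => [|a [|b l]] //=; first by case: (n).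
    by move=> _ _ /and3P[/eqP -> /eqP -> _]; rewrite /normalize /= /rgt lt_irr.
  - exact: in_complex_cellsB CB.
transitivity (\xor_(s <- z) (phi [:: x0] && \xor_(t <- faces s) true)); last first.
  by rewrite xor_andl; case: cz => _ ->; rewrite andbF.
apply: eq_big_seq => s zs; have [ss sz] := z_sorted zs.
rewrite xor_const size_faces sz n0 /= andbT.
(* With the constant cochain this says that each point of [z] has an odd number of cells. *)
have := flagsum_cellsB N_gt0 lt_irr lt_trans lab_bottom x0 sz ss predT.
rewrite n0 /= {1}/normalize => e; rewrite -[RHS]andbT -[in RHS]e -xor_andl.
apply: eq_big_seq => C CB; rewrite /labt /= lab_top ?andbT //.
exact: in_complex_cellsB CB.
Qed.

Lemma prism_vanish : \xor_(s <- z) phi s = false.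
Proof.
rewrite -slice_bottom -slice_top.
have : L <= L by []. elim: {1 3}L => // j IH jL.
by rewrite doubleS -slice_step // IH // ltnW.
Qed.

End Prism.

(** * Enumeration of the posets without beat points *)

Definition eqs (s t : seq nat) := all2 eqn s t.
Definition mems (c : seq nat) (z : seq (seq nat)) := has (eqs c) z.

(* A degree, a mod 2 cocycle and a mod 2 cycle with non-zero pairing. *)
Definition certificate := (nat * (seq (seq nat) * seq (seq nat)))%type.

(** * Tests on one poset: beat points and homology certificates *)

Section Leaf.
Variables (n : nat) (D : seq (seq bool)).

Definition ltD i j := nth false (nth [::] D j) i.
Let pts := iota 0 n.
Definition downs j := [seq i <- pts | ltD i j].

(* Conditionals stand for connectives in the search: call-by-value evaluation
   computes both arguments of [&&] and [||]. *)
Definition upbeatb := has (fun x =>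
  let u := [seq j <- pts | ltD x j] in
  if u is _ :: _ then let y := last 0 u in all (fun z => eqn z y || ltD y z) u else false) pts.

Fixpoint chains_from k j : seq (seq nat) :=
  if k is k'.+1 then [seq j :: c | c <- flatten [seq chains_from k' i | i <- downs j]]
  else [:: [:: j]].

Definition chains k := flatten [seq chains_from k j | j <- pts].

Definition cocycleb k phi := all (fun c => ~~ odd (count (mems^~ phi) (faces c))) (chains k.+1).

Definition cycleb k z :=
  if all (fun c => mems c (chains k)) z then
    let fs := flatten (map (@faces nat) z) in all (fun f => ~~ odd (count (eqs f) fs)) fs
  else false.

(** The only test of non-acyclicity whose soundness matters; the ways of finding certificates below
    are heuristics. *)
Definition certifies (w : certificate) :=
  let: (k, (phi, z)) := w in
  if odd (count (mems^~ phi) z) then if cycleb k z then cocycleb k phi else false else false.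

Definition adj i j := ltD i j || ltD j i.
Definition edge i j := if ltD i j then [:: j; i] else [:: i; j].

Fixpoint grow fuel todo front acc : seq nat :=
  if fuel is f.+1 then
    let new := [seq v <- todo | has (adj v) front] in
    if new is _ :: _ then grow f [seq v <- todo | ~~ has (adj v) front] new (new ++ acc) else acc
  else acc.

Fixpoint search_path fuel todo (ps : seq (seq nat)) (goal : pred nat) : seq nat :=
  if fuel is f.+1 then
    if [seq p <- ps | goal (head 0 p)] is p :: _ then p else
    let ext v := if [seq p <- ps | adj v (head 0 p)] is p :: _ then [:: v :: p] else [::] in
    let new := flatten [seq ext v | v <- todo] in
    if new is _ :: _ then
      search_path f [seq v <- todo | ~~ has (fun p => adj v (head 0 p)) ps] new goal
    else [::]
  else [::].

Fixpoint path_edges x p := if p is y :: p' then edge x y :: path_edges y p' else [::].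

(* If two components of the link of an extremal point x are connected outside
   x, the edges from x to one of them form a cocycle which is not a coboundary. *)
Definition star_certificate x : seq certificate :=
  let lk := [seq j <- pts | adj x j] in
  if nilp (downs x) || eqn (size (downs x)) (size lk) then
    (fix go l := if l is y :: l' then
       let c := grow n [seq v <- lk | ~~ eqn v y] [:: y] [:: y] in
       let goal v := has (eqn v) lk && ~~ has (eqn v) c in
       let todo := [seq v <- pts | ~~ (eqn x v || has (eqn v) c)] in
       if search_path n todo [seq [:: y] | y <- c] goal is h :: p then
         [:: (1, ([seq edge x v | v <- c], edge x h :: edge (last h p) x :: path_edges h p))]
       else go l'
     else [::]) lk
  else [::].

Fixpoint vadd (u v : seq bool) :=
  if u is a :: u' then if v is b :: v' then addb a b :: vadd u' v' else [::] else [::].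

Fixpoint pick_pivot (rs : seq (seq bool * seq bool)) :=
  if rs is (a, b) :: rs' then
    if a is true :: a' then (Some (a', b), rs')
    else let: (o, l) := pick_pivot rs' in (o, (a, b) :: l)
  else (None, [::]).

(** Each row is paired with the combination of original rows that produced it. Once the [w] columns
    are cleared and the pivot rows dropped, these combinations form a basis of the relations between
    rows. *)
Fixpoint left_kernel w (rs : seq (seq bool * seq bool)) : seq (seq bool) :=
  if w is w'.+1 then
    let: (o, rs') := pick_pivot rs in
    left_kernel w' (if o is Some (a, b) then
      [seq (if r.1 is true :: r1 then (vadd r1 a, vadd r.2 b) else (behead r.1, r.2)) | r <- rs']
    else [seq (behead r.1, r.2) | r <- rs'])
  else map snd rs.

Definition unit_vector k i := [seq eqn i j | j <- iota 0 k].

Definition row_kernel (A : seq (seq bool)) w :=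
  left_kernel w (zip A [seq unit_vector (size A) i | i <- iota 0 (size A)]).

(** Cycles are the relations between the rows of the face matrix in degree [k], cocycles those
    between the rows of the transposed matrix one degree higher. *)
Definition gauss_certificate k : seq certificate :=
  let: (ch0, (ch1, ch2)) := (chains k.-1, (chains k, chains k.+1)) in
  let Z := row_kernel [seq (let fs := faces c in [seq mems b fs | b <- ch0]) | c <- ch1] (size ch0) in
  if Z is z0 :: _ then
    (* When there is no chain of degree [k.+1] every cochain is a cocycle, so the indicator of one
       chain occurring in [z0] does. *)
    let F := if ch2 is [::] then [:: unit_vector (size ch1) (find id z0)]
             else row_kernel [seq [seq mems c (faces t) | t <- ch2] | c <- ch1] (size ch2) in
    [seq (k, (mask pz.1 ch1, mask pz.2 ch1)) |
      pz <- [seq (p, z) | p <- F, z <- Z] & odd (count (fun a => a.1 && a.2) (zip pz.1 pz.2))]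
  else [::].

Definition nonacyclicb :=
  if flatten (map star_certificate pts) is w :: _ then certifies w else
  if gauss_certificate 2 is w :: _ then certifies w else
  if gauss_certificate 1 is w :: _ then certifies w else
  if gauss_certificate 3 is w :: _ then certifies w else false.

(* Column i of row j tells whether point number i is below point number j. *)
Definition P_matrix : seq (seq bool) := map (map (fun k => k != 0))
  [:: [:: 0; 0; 0; 1; 1; 0; 1; 1; 1];
      [:: 0; 0; 0; 1; 0; 1; 1; 1; 1];
      [:: 0; 0; 0; 0; 1; 1; 1; 1; 1];
      [:: 0; 0; 0; 0; 0; 0; 1; 1; 0];
      [:: 0; 0; 0; 0; 0; 0; 1; 1; 1];
      [:: 0; 0; 0; 0; 0; 0; 0; 1; 1]; [::]; [::]; [::] ].

Definition same_bool (a b : bool) := if a then b else ~~ b.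

Definition isob (p : seq nat) := all (fun i => all (fun j =>
  same_bool (nth false (nth [::] P_matrix j) i) (ltD (nth 0 p i) (nth 0 p j))) (iota 0 9)) (iota 0 9).
Definition antiisob (p : seq nat) := all (fun i => all (fun j =>
  same_bool (nth false (nth [::] P_matrix j) i) (ltD (nth 0 p j) (nth 0 p i))) (iota 0 9)) (iota 0 9).

End Leaf.

(** [P] has three levels of three points and the numbering puts maximal points first, minimal ones
    last: an isomorphism permutes each of the three blocks. *)
Definition perms3 k := [:: [:: k; k.+1; k.+2]; [:: k; k.+2; k.+1]; [:: k.+1; k; k.+2];
  [:: k.+1; k.+2; k]; [:: k.+2; k; k.+1]; [:: k.+2; k.+1; k]].
Definition level_perms := [seq a ++ b | a <- [seq a ++ b | a <- perms3 0, b <- perms3 3], b <- perms3 6].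

Definition is_P_or_dual D := if has (isob D) level_perms then true
  else has (fun p => antiisob D (rev p)) level_perms.

(* A poset is given by rows [rs], the last added point coming first: each row
   tells which of the points added earlier lie below the given one. *)
Fixpoint full_matrix k (rs : seq (seq bool)) :=
  if rs is r :: rs' then (nseq k.+1 false ++ r) :: full_matrix k.+1 rs' else [::].

(** Only up beat points are tested, because the search below never generates a down beat point. *)
Definition leafb n rs :=
  let D := full_matrix 0 rs in
  if upbeatb n D then true else if nonacyclicb n D then true else if eqn n 9 then is_P_or_dual D else false.

(** * The search tree *)

Definition subm := all2 implb.

Fixpoint maximals (rs : seq (seq bool)) : seq bool :=
  if rs is r :: rs' then true :: [seq p.1 && ~~ p.2 | p <- zip (maximals rs') r] else [::].

(* A non-maximal point that is so far below no other one needs at least two of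
   the maximal points above it, the [acc] chosen ones and the [r] missing ones. *)
Definition hopeless (tops : seq bool) (acc : seq (seq bool)) r :=
  has (fun i => nth false tops i && (count (fun d => nth false d i) acc + r < 2)) (iota 0 (size tops)).

Fixpoint add_maximal (acc rs : seq (seq bool)) :=
  if acc is d :: acc' then (nseq (size acc') false ++ d) :: add_maximal acc' rs else rs.

Fixpoint antichain l : seq (seq bool) := if l is l'.+1 then nseq l' false :: antichain l' else [::].

Fixpoint all_masks k : seq (seq bool) :=
  if k is k'.+1 then map (cons false) (all_masks k') ++ map (cons true) (all_masks k') else [:: [::]].

Section Search.
Variable check : seq (seq bool) -> bool.

Fixpoint search_max r rs tops cs acc :=
  if hopeless tops acc r then true else
  if r is r'.+1 then
    (fix go cs := if cs is d :: cs' then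
       if search_max r' rs tops cs (d :: acc) then go cs' else false else true) cs
  else check (add_maximal acc rs).

(* Points are added along a linear extension, minimal ones first and maximal ones
   last; [f.+2] points are missing. A mask is the set of present points below a
   missing one: [al] contains the masks of all missing points, [nb] those of the
   points whose predecessors are all present, and [cs] those of the non-maximal
   points among the latter. The next point is taken with its mask as early as
   possible in [cs], whence the removal of the masks that precede it. *)
Fixpoint search_mid f rs al nb cs :=
  if search_max f.+2 rs (maximals rs) nb [::] then
    if f is f'.+1 then
      (fix go cs := if cs is d :: cs' then
         let up := [seq d' <- al | subm d d'] in
         let new := [seq true :: d' | d' <- up & ~~ subm d' d] in
         if search_mid f' (d :: rs) (map (cons false) al ++ map (cons true) up)
              (map (cons false) nb ++ new) (map (cons false) cs ++ new)
         then go cs' else false else true) cs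
    else true
  else false.

(** A non-minimal point whose predecessors are all minimal has at least two of them, otherwise it
    would be a down beat point. *)
Definition search l f :=
  let nb := [seq d <- all_masks l | 1 < count id d] in
  search_mid f (antichain l) (all_masks l) nb nb.

End Search.

(** There are at least two minimal and two maximal points and none is both, so [l] runs from 2 to
    [n - 2]. *)
Definition search_all n := all (fun l => search (leafb n) l (n - l - 2)) (iota 2 (n - 3)).

Lemma search_all_true : all search_all (iota 2 8) = true.
Proof. by vm_cast_no_check (erefl true). Qed.

(** * Soundness of the tests at a leaf *)

Lemma eqsE s t : eqs s t = (s == t).
Proof. by elim: s t => [|x s IH] [|y t] //=; rewrite IH. Qed.

Lemma memsE c z : mems c z = (c \in z).
Proof. by rewrite -has_pred1; apply: eq_has => d; rewrite eqsE eq_sym. Qed.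

Lemma xor_even (T : eqType) (r : seq T) (h : pred T) :
  (forall x, x \in r -> ~~ odd (count_mem x r)) -> \xor_(x <- r) h x = false.
Proof.
have iterE k b : iterop k addb b false = odd k && b.
  case: k => // k; rewrite iteropS /=.
  by case: b; elim: k => //= k ->; case: odd.
move=> H; rewrite -big_undup_iterop_count; apply: big1_seq => x /=.
by rewrite mem_undup iterE => /H /negPf ->.
Qed.

Section Order.
Variables (T : eqType) (lt : rel T).
Hypotheses (lt_irr : irreflexive lt) (lt_trans : transitive lt).
Notation gt := (rgt lt).

Definition lt_mask xs y := [seq lt x y | x <- xs].

Fixpoint lt_rows xs := if xs is x :: xs' then lt_mask xs' x :: lt_rows xs' else [::].

(** Lists of points start with the last added one: [pairwise not_below] says that the reversed list
    is a linear extension. *)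
Definition not_below : rel T := fun x y => ~~ lt x y.

Section Leaf.
Variables (x0 : T) (ys : seq T).
Hypotheses (uys : uniq ys) (ys_lin : pairwise not_below ys) (ys_all : forall x, x \in ys).
Let n := size ys.
Let D := full_matrix 0 (lt_rows ys).
Let y i := nth x0 ys i.
Let idx x := index x ys.

Lemma nth_full_matrix k xs i j : j < size xs ->
  nth false (nth [::] (full_matrix k (lt_rows xs)) j) i =
  (k + j < i) && nth false (lt_mask (drop j.+1 xs) (nth x0 xs j)) (i - (k + j).+1).
Proof.
elim: xs k j => // x xs IH k [|j]; last by rewrite /= ltnS => /(IH k.+1) ->; rewrite addSnnS.
move=> _; rewrite [LHS](_ : _ = nth false (nseq k.+1 false ++ lt_mask xs x) i) //.
rewrite addn0 /= drop0 -[false :: _]/(nseq k.+1 false ++ _) nth_cat nth_nseq size_nseq ltnS.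
by case: (leqP i k); rewrite ?if_same // ltnNge => ->.
Qed.

Lemma ltDE i j : i < n -> j < n -> ltD D i j = lt (y i) (y j).
Proof.
move=> i_n jn; rewrite /ltD nth_full_matrix // add0n.
case: (ltnP j i) => ij /=; last first.
  case: (ltngtP i j) ij => // [ij _|-> _]; last by rewrite lt_irr.
  apply/esym/negbTE; move/pairwiseP: ys_lin => /(_ x0 i j); rewrite !inE; exact.
rewrite /lt_mask (nth_map x0) ?size_drop ?ltn_sub2r // ?(leq_ltn_trans ij) //.
  by rewrite nth_drop subnKC.
Qed.

Lemma y_idx x : y (idx x) = x. Proof. exact: nth_index. Qed.
Lemma idx_lt x : idx x < n. Proof. by rewrite index_mem. Qed.
Lemma idx_y i : i < n -> idx (y i) = i. Proof. by move=> ?; rewrite /idx index_uniq. Qed.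

Lemma ltD_idx a b : ltD D (idx a) (idx b) = lt a b.
Proof. by rewrite ltDE ?idx_lt // !y_idx. Qed.

Lemma mem_downs i j : j < n -> (i \in downs n D j) = (i < n) && lt (y i) (y j).
Proof.
move=> jn; rewrite mem_filter mem_iota add0n leq0n /= andbC.
by case: (ltnP i n) => //= i_n; rewrite ltDE.
Qed.

Lemma upbeat_sound : upbeatb n D ->
  exists a b, lt a b /\ forall c, lt a c -> c = b \/ lt b c.
Proof.
case/hasP => i; rewrite mem_iota add0n => /andP[_ i_n].
case eu : [seq j <- iota 0 n | ltD D i j] => [|u0 u] // /allP H.
set j := last 0 (u0 :: u) in H.
have : j \in u0 :: u by exact: mem_last.
rewrite -eu mem_filter mem_iota add0n => /andP[ij /andP[_ jn]].
exists (y i), (y j); rewrite -ltDE //; split=> // c ac.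
have : idx c \in u0 :: u by rewrite -eu mem_filter mem_iota add0n idx_lt -(idx_y i_n) ltD_idx ac.
move/H => /orP[/eqnP e|]; first by left; rewrite -e y_idx.
by move=> ltjc; right; rewrite -[c]y_idx -ltDE ?idx_lt.
Qed.

Lemma chains_fromP k j c : j < n ->
  c \in chains_from n D k j -> [/\ size c = k.+1, all (fun i => i < n) c, head j c = j & sorted gt (map y c)].
Proof.
elim: k j c => [|k IH] j c jn /=; first by rewrite inE => /eqP -> /=; rewrite jn.
case/mapP => d /flattenP[? /mapP[i]]; rewrite mem_downs // => /andP[i_n lij] -> dc ->.
have [sd dn hd gd] := IH _ _ i_n dc; split=> //=; [by rewrite sd|by rewrite jn|].
by case: d sd hd gd {dc dn} => //= a d _ -> ->; rewrite /rgt lij.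
Qed.

Lemma chainsP k c : c \in chains n D k -> [/\ size c = k.+1, all (fun i => i < n) c & sorted gt (map y c)].
Proof.
case/flattenP => ? /mapP[j]; rewrite mem_iota add0n => /andP[_ jn] -> /chains_fromP.
by case/(_ jn).
Qed.

Lemma mem_chains_from s a : sorted gt (a :: s) ->
  map idx (a :: s) \in chains_from n D (size s) (idx a).
Proof.
elim: s a => [|b s IH] a; first by rewrite /= inE.
move=> /= /andP[ab gs]; apply: map_f; apply/flattenP.
exists (chains_from n D (size s) (idx b)); last exact: IH.
by apply: map_f; rewrite mem_downs ?idx_lt // !y_idx.
Qed.

Lemma mem_chains s k : size s = k.+1 -> sorted gt s -> map idx s \in chains n D k.
Proof.
case: s => // a s [<-] gs; apply/flattenP; exists (chains_from n D (size s) (idx a)).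
  by apply: map_f; rewrite mem_iota add0n idx_lt.
exact: mem_chains_from.
Qed.

(** The cycle is carried to [T] by [y] and the cocycle by [idx]. Every chain of [T] has its index
    list in [chains], so the finite check covers all of them. *)
Lemma certifies_sound w : certifies n D w -> ~ acyclic lt.
Proof.
case: w => k [phi z] /=; case: ifP => // oz; case: ifP => // cz cphi.
move: cz; rewrite /cycleb; case: ifP => // /allP zc /allP fz ac.
pose phi' : pred (seq T) := fun s => map idx s \in phi.
have := ac k phi' (map (map y) z); rewrite big_map.
have -> : \xor_(c <- z) phi' (map y c) = true.
  rewrite xor_odd_count -[RHS]oz; congr (odd _); apply: eq_in_count => c cz.
  rewrite memsE /phi' -map_comp map_id_in //.
  have := zc c cz; rewrite memsE => /chainsP[_ /allP cn _] i ic /=; exact: idx_y (cn _ ic).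
move=> H; suff: true = false by []; apply: H.
  move=> s ss gs; rewrite xor_odd_count; apply/negbTE.
  have := allP cphi _ (mem_chains ss gs); rewrite -map_faces count_map.
  by congr (~~ odd _); apply: eq_count => t; rewrite /= memsE.
split.
  rewrite all_map; apply/allP => c /zc; rewrite memsE => /chainsP[sc _ gc] /=.
  by rewrite gc size_map sc eqxx.
move=> h; rewrite big_map; transitivity (\xor_(f <- flatten (map (@faces nat) z)) h (map y f)).
  by rewrite big_flatten big_map; apply: eq_bigr => c _; rewrite -map_faces big_map.
apply: xor_even => f ff; have := fz _ ff; congr (~~ odd _).
by apply: eq_count => g; rewrite /= eqsE eq_sym.
Qed.

Lemma nonacyclic_sound : nonacyclicb n D -> ~ acyclic lt.
Proof.
rewrite /nonacyclicb; case: (flatten _) => [|w _]; last exact: certifies_sound.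
case: gauss_certificate => [|w _]; last exact: certifies_sound.
case: gauss_certificate => [|w _]; last exact: certifies_sound.
by case: gauss_certificate => [|w _] //; exact: certifies_sound.
Qed.

Lemma level_perms_uniq : all (fun p => uniq p && all (fun i => i < 9) p && (size p == 9)) level_perms.
Proof. by vm_compute. Qed.

Definition P_lt_code i j := nth false (nth [::] P_matrix j) i.

Lemma Pb_sound : n = 9 -> is_P_or_dual D -> exists p : seq T,
  [/\ uniq p, size p = 9 &
      (forall i j, i < 9 -> j < 9 -> lt (nth x0 p i) (nth x0 p j) = P_lt_code i j) \/
      (forall i j, i < 9 -> j < 9 -> lt (nth x0 p j) (nth x0 p i) = P_lt_code i j)].
Proof.
move=> n9; have eqbE a b : same_bool a b -> b = a by case: a; case: b.
have key p : uniq p && all (fun i => i < 9) p && (size p == 9) ->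
  [/\ uniq (map y p), size (map y p) = 9 & forall i j, i < 9 -> j < 9 ->
     lt (nth x0 (map y p) i) (nth x0 (map y p) j) = ltD D (nth 0 p i) (nth 0 p j)].
  move=> /andP[/andP[up /allP p9] /eqP sp]; split=> [||i j i9 j9].
  - rewrite map_inj_in_uniq // => i j /p9 i9 /p9 j9 /(congr1 idx).
    by rewrite !idx_y // n9.
  - by rewrite size_map.
  - by rewrite !(nth_map 0) ?sp // ltDE // n9; apply: p9; rewrite mem_nth ?sp.
have lvl p := allP level_perms_uniq p.
rewrite /is_P_or_dual; case: ifPn => [/hasP[p /lvl/key[up sp H] /allP iso] _|_ /hasP[p /lvl + /allP iso]].
  exists (map y p); split=> //; left=> i j i9 j9; rewrite H //.
  by have /allP/(_ j) := iso i ltac:(by rewrite mem_iota); rewrite mem_iota => /(_ j9)/eqbE.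
rewrite -[p in uniq p]revK -[p in all _ p]revK -[p in size p]revK rev_uniq all_rev size_rev => /key[up sp H].
exists (map y (rev p)); split=> //; right=> i j i9 j9; rewrite H //.
by have /allP/(_ j) := iso i ltac:(by rewrite mem_iota); rewrite mem_iota => /(_ j9)/eqbE.
Qed.

End Leaf.
End Order.

(** Justifies the removal of masks in the search: those before the first one carried by an element
    of [s] are carried by no element of [s]. *)
Lemma pick_first (U V : eqType) (s : seq U) (f : U -> V) cs :
  s != [::] -> (forall u, u \in s -> f u \in cs) ->
  exists ch1 ch2 u, [/\ cs = ch1 ++ f u :: ch2, u \in s & forall v, v \in s -> f v \in f u :: ch2].
Proof.
move=> s0; elim: cs => [|c cs IH] H; first by case: s s0 H => // u s _ /(_ u (mem_head _ _)).
have [/hasP[u us /eqP fu]|/hasPn nu] := boolP (has (fun u => f u == c) s).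
  by exists [::], cs, u; rewrite fu; split.
have [u us|ch1 [ch2 [u [-> us Hu]]]] := IH; first by have := H u us; rewrite inE (negPf (nu u us)).
by exists (c :: ch1), ch2, u.
Qed.

(** * Completeness of the search *)

Section SearchSound.
Variables (T : finType) (lt : rel T).
Hypotheses (lt_irr : irreflexive lt) (lt_trans : transitive lt).
Hypothesis no_up : forall a b, lt a b -> exists c, [/\ lt a c, c != b & ~~ lt b c].
Hypothesis no_down : forall a b, lt b a -> exists c, [/\ lt c a, c != b & ~~ lt c b].
Variable check : seq (seq bool) -> bool.
Notation not_below := (not_below lt).
Notation mask := (lt_mask lt).
Notation rows := (lt_rows lt).

Definition maximal x := [forall y, ~~ lt x y].
Definition minimal x := [forall y, ~~ lt y x].

Lemma maximalF x y : maximal x -> lt x y = false.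
Proof. by move/forallP/(_ y)/negbTE. Qed.

Lemma minimalF x y : minimal x -> lt y x = false.
Proof. by move/forallP/(_ y)/negbTE. Qed.

Lemma nonmaximalP x : ~~ maximal x -> exists y, lt x y.
Proof. by rewrite negb_forall => /existsP[y]; rewrite negbK; exists y. Qed.

Lemma lt_nonmaximal x y : lt x y -> ~~ maximal x.
Proof. by move=> xy; apply: contraL xy => /maximalF ->. Qed.

(** A successful search accepts all its leaves; completeness means that some linear extension of
    [lt] is one of them. *)
Definition checked := exists ys,
  [/\ uniq ys, pairwise not_below ys, forall x, x \in ys & check (rows ys)].

Lemma maximals_rows xs : pairwise not_below xs -> maximals (rows xs) = [seq ~~ has (lt x) xs | x <- xs].
Proof.
elim: xs => //= x xs IH /andP[/allP nx /IH ->]; rewrite lt_irr /=; congr (_ :: _).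
  by apply/esym/hasPn => y /nx.
rewrite /lt_mask zip_map -map_comp; apply: eq_map => y /=.
by rewrite negb_or andbC.
Qed.

Section Max.
Variable xs : seq T.
Hypotheses (uxs : uniq xs) (xs_lin : pairwise not_below xs).
Hypothesis xsE : forall x, (x \in xs) = ~~ maximal x.

Lemma add_maximal_rows acc : all maximal acc ->
  add_maximal (map (mask xs) acc) (rows xs) = rows (acc ++ xs).
Proof.
elim: acc => //= a acc IH /andP[ma macc]; rewrite IH // size_map; congr (_ :: _).
rewrite /lt_mask map_cat; congr (_ ++ _).
by elim: acc macc {IH} => //= b acc IH /andP[mb /IH <-]; rewrite maximalF.
Qed.

(** Above a point that is maximal within [xs] there are only maximal points of [T], at least two by
    [no_up]; those not chosen yet are in [rs]. *)
Lemma not_hopeless rs acc : uniq (rs ++ acc) -> (forall x, (x \in rs ++ acc) = maximal x) ->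
  ~~ hopeless (maximals (rows xs)) (map (mask xs) acc) (size rs).
Proof.
move=> ura raE; rewrite maximals_rows //; apply/hasPn => i; rewrite size_map mem_iota add0n => /andP[_ ixs].
have /nonmaximalP[x0 _] : ~~ maximal (tnth (in_tuple xs) (Ordinal ixs)) by rewrite -xsE mem_tnth.
rewrite (nth_map x0) //; set x := nth x0 xs i; rewrite negb_and negbK.
have [//|/= /hasPn nx] := boolP (has (lt x) xs); rewrite -leqNgt count_map.
have -> : count (preim (mask xs) (fun d => nth false d i)) acc = count (lt x) acc.
  by apply: eq_count => y /=; rewrite (nth_map x0).
have xm : ~~ maximal x by rewrite -xsE mem_nth.
have [y xy] := nonmaximalP xm; have [z [xz zy _]] := no_up xy.
have above w : lt x w -> w \in seq.filter (lt x) (rs ++ acc).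
  by move=> xw; rewrite mem_filter xw raE -[maximal w]negbK -xsE; apply: contraL xw => /nx.
have : size [:: y; z] <= size (seq.filter (lt x) (rs ++ acc)).
  apply: uniq_leq_size; first by rewrite /= inE eq_sym zy.
  by move=> w; rewrite !inE => /orP[] /eqP ->; exact: above.
by rewrite size_filter count_cat => /leq_trans -> //; rewrite addnC leq_add2l count_size.
Qed.

(** Maximal points are taken in the order of their masks in [cs]. A mask just used stays in the
    list, as several maximal points may share it. *)
Lemma search_max_sound r rs acc cs : size rs = r -> uniq (rs ++ acc) ->
  (forall x, (x \in rs ++ acc) = maximal x) -> (forall x, x \in rs -> mask xs x \in cs) ->
  search_max check r (rows xs) (maximals (rows xs)) cs (map (mask xs) acc) -> checked.
Proof.
elim: r rs acc cs => [|r IH] rs acc cs srs ura raE rscs /=;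
  rewrite -{1}srs (negPf (not_hopeless ura raE)).
  move/size0nil: srs => srs; rewrite srs /= in ura raE.
  have macc : all maximal acc by apply/allP => x; rewrite raE.
  rewrite add_maximal_rows // => ok; exists (acc ++ xs); split=> //.
  - rewrite cat_uniq ura uxs andbT; apply/hasPn => x; rewrite xsE raE; exact.
  - rewrite pairwise_cat xs_lin andbT; apply/andP; split.
      by apply/allrelP => a b; rewrite raE /not_below => /maximalF ->.
    elim: (acc) macc => //= a s IHs /andP[ma /IHs ->]; rewrite andbT.
    by apply/allP => b _; rewrite /not_below maximalF.
  - by move=> x; rewrite mem_cat raE xsE orbN.
have [|ch1 [ch2 [y [-> yrs Hy]]]] := pick_first _ rscs; first by case: (rs) srs.
elim: ch1 => [|d ch1 IHc] /=; last by case: ifP => // _; exact: IHc.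
case: ifP => // ok _; apply: (IH (rem y rs) (y :: acc) (mask xs y :: ch2)) => //.
- by rewrite size_rem // srs.
- have /perm_uniq <- : perm_eq (rs ++ acc) (rem y rs ++ y :: acc); last exact: ura.
  apply: perm_trans (perm_cat (perm_to_rem yrs) (perm_refl acc)) _.
  by rewrite /= -(cat1s y (_ ++ _)) -(cat1s y acc) perm_catCA.
- move=> x; rewrite -raE mem_cat inE mem_cat (perm_mem (perm_to_rem yrs)) inE.
  by case: (x == y); case: (x \in rem y rs).
- by move=> x /mem_rem/Hy.
Qed.

End Max.

Lemma search_mid_max f rs al nb cs :
  search_mid check f rs al nb cs -> search_max check f.+2 rs (maximals rs) nb [::].
Proof. by case: f => [|f]; cbn [search_mid]; case: (search_max _ _ _ _ _ _). Qed.

Lemma search_mid_step f rs al nb ch1 d ch2 :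
  search_mid check f.+1 rs al nb (ch1 ++ d :: ch2) ->
  let up := [seq d' <- al | subm d d'] in
  let new := [seq true :: d' | d' <- up & ~~ subm d' d] in
  search_mid check f (d :: rs) (map (cons false) al ++ map (cons true) up)
    (map (cons false) nb ++ new) (map (cons false) (d :: ch2) ++ new).
Proof.
cbn [search_mid]; case: (search_max _ _ _ _ _ _) => //.
elim: ch1 => [|e ch1 IH]; cbn [cat]; first by case: (search_mid check f (d :: rs) _ _ _).
by case: (search_mid check f (e :: rs) _ _ _) => // /IH.
Qed.

Lemma subm_mask xs x y : subm (mask xs x) (mask xs y) = all (fun z => lt z x ==> lt z y) xs.
Proof. by rewrite /subm; elim: xs => //= z xs ->. Qed.

Hypothesis max2 : 1 < #|maximal|.

Lemma search_mid_finish f xs al nb cs :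
  uniq xs -> pairwise not_below xs -> #|T| = size xs + f.+2 ->
  (forall y, y \notin xs -> (forall z, lt z y -> z \in xs) -> mask xs y \in nb) ->
  search_mid check f (rows xs) al nb cs -> (forall x, (x \in xs) = ~~ maximal x) -> checked.
Proof.
move=> uxs xs_lin cT nb_P /search_mid_max ok xsE.
have nmE : #|[predC maximal]| = size xs.
  by rewrite -(card_uniqP uxs); apply: eq_card => x; rewrite xsE !inE.
apply: (@search_max_sound xs uxs xs_lin xsE f.+2 (enum maximal) [::] nb) ok.
- by rewrite -cardE; apply/eqP; rewrite -(eqn_add2r (size xs)) -{1}nmE cardC cT addnC.
- by rewrite cats0 enum_uniq.
- by move=> x; rewrite cats0 mem_enum.
- move=> x; rewrite mem_enum => mx; apply: nb_P; first by rewrite xsE negbK.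
  by move=> z zx; rewrite xsE (lt_nonmaximal zx).
Qed.

(** The hypotheses are the invariants of the search: [xs] is a down-set with all minimal and no
    maximal points, and the three lists of masks are large enough. *)
Lemma search_mid_sound f xs al nb cs :
  uniq xs -> pairwise not_below xs -> (forall x y, x \in xs -> lt y x -> y \in xs) ->
  (forall x, x \in xs -> ~~ maximal x) -> (forall x, minimal x -> x \in xs) ->
  #|T| = size xs + f.+2 ->
  (forall y, y \notin xs -> mask xs y \in al) ->
  (forall y, y \notin xs -> (forall z, lt z y -> z \in xs) -> mask xs y \in nb) ->
  (forall y, y \notin xs -> ~~ maximal y -> (forall z, lt z y -> z \in xs) -> mask xs y \in cs) ->
  search_mid check f (rows xs) al nb cs -> checked.
Proof.
elim: f xs al nb cs => [|f IH] xs al nb cs uxs xs_lin xs_down xs_nm minxs cT al_P nb_P cs_P H;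
  have [all_nm|nall] := boolP [forall x, (x \in xs) == ~~ maximal x].
- by apply: search_mid_finish H _ => // x; apply/eqP/(forallP all_nm).
- have [x0 xn] : exists x, (x \notin xs) && ~~ maximal x.
    move: nall; rewrite negb_forall => /existsP[x]; rewrite -[x \in xs](negbK) => nx.
    by exists x; have := xs_nm x; move: nx; case: (x \in xs); case: (maximal x) => //= _ /(_ isT).
  (* Only two points are missing and at least two are maximal, which leaves no room for a missing
     non-maximal one. *)
  have : #|[predU1 x0 & xs]| <= #|[predC maximal]|.
    apply/subset_leq_card/fintype.subsetP => x; rewrite !inE => /predU1P[->|/xs_nm //].
    by case/andP: xn.
  rewrite cardU1; case/andP: xn => -> _ /=; rewrite (card_uniqP uxs) => le.
  by have := leq_add max2 le; rewrite (cardC maximal) cT [2 + _]addnC leq_add2r ltnn.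
- by apply: search_mid_finish H _ => // x; apply/eqP/(forallP all_nm).
pose av := [seq y <- enum T | [&& y \notin xs, ~~ maximal y & [forall z, lt z y ==> (z \in xs)]]].
have avE y : (y \in av) = [&& y \notin xs, ~~ maximal y & [forall z, lt z y ==> (z \in xs)]].
  by rewrite mem_filter mem_enum andbT.
have [||ch1 [ch2 [y [csE yav Hy]]]] := @pick_first _ _ av (mask xs) cs.
- have [x0 xn] : exists x, (x \notin xs) && ~~ maximal x.
    move: nall; rewrite negb_forall => /existsP[x]; rewrite -[x \in xs](negbK) => nx.
    by exists x; have := xs_nm x; move: nx; case: (x \in xs); case: (maximal x) => //= _ /(_ isT).
  (* A missing non-maximal point with fewest points below is available: a missing point below it
     would be non-maximal with still fewer. *)
  have [x /andP[xxs xm] xmin] := @arg_minnP _ x0 (fun x => (x \notin xs) && ~~ maximal x)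
    (fun x => #|[pred w | lt w x]|) xn.
  rewrite -size_eq0 -lt0n -has_predT; apply/hasP; exists x => //; rewrite avE xxs xm /=.
  apply/forallP => z; apply/implyP => zx; apply: contraTT isT => zxs.
  have := xmin z; rewrite zxs (lt_nonmaximal zx) => /(_ isT); rewrite leqNgt => /negP[].
  apply: proper_card; apply/fintype.properP; split.
    by apply/fintype.subsetP => w; rewrite !inE => /lt_trans; apply.
  by exists z; rewrite !inE // lt_irr.
- move=> y; rewrite avE => /and3P[yxs ym /forallP yz]; apply: cs_P => // z zy.
  by have := yz z; rewrite zy.
move: yav; rewrite avE => /and3P[yxs ym /forallP yz].
have {}yz z : lt z y -> z \in xs by move=> zy; have := yz z; rewrite zy.
rewrite csE in H; have {H} := search_mid_step H; cbv zeta.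
set up := seq.filter _ al; set new := map _ (seq.filter _ up) => H.
have upP z : z \notin xs -> lt y z -> mask xs z \in up.
  move=> zxs yltz; rewrite mem_filter al_P // andbT subm_mask; apply/allP => w _.
  by apply/implyP => /lt_trans; apply.
(* The filter [~~ subm d' d] loses nothing: by [no_down], a point above [y] has a predecessor other
   than [y] and not below [y]. *)
have newP z : z \notin xs -> lt y z -> (forall w, lt w z -> w \in y :: xs) -> true :: mask xs z \in new.
  move=> zxs yltz zav; apply: map_f; rewrite mem_filter upP // andbT subm_mask.
  have [w [wz wy nwy]] := no_down yltz.
  have wxs : w \in xs by have := zav w wz; rewrite inE (negPf wy).
  by apply/negP => /allP/(_ w wxs); rewrite wz (negPf nwy).
have av_xs z : ~~ lt y z -> (forall w, lt w z -> w \in y :: xs) -> forall w, lt w z -> w \in xs.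
  move=> nyz zav w wz; have := zav w wz; rewrite inE; case: eqP => // wy.
  by rewrite -wy wz in nyz.
have maskE z : mask (y :: xs) z = lt y z :: mask xs z by [].
apply: (IH (y :: xs)) H => //.
- by rewrite /= yxs.
- rewrite /= xs_lin andbT; apply/allP => x xxs; apply/negP => yx.
  by have := xs_down _ _ xxs yx; rewrite (negPf yxs).
- move=> x z; rewrite !inE => /predU1P[->|xxs zx]; first by move/yz ->; rewrite orbT.
  by rewrite (xs_down _ _ xxs zx) orbT.
- by move=> x; rewrite inE => /predU1P[->//|/xs_nm].
- by move=> x /minxs xxs; rewrite inE xxs orbT.
- by rewrite cT /= !addnS.
- move=> z; rewrite inE negb_or => /andP[_ zxs]; rewrite mem_cat maskE.
  case: (boolP (lt y z)) => yltz; apply/orP; [right | left]; apply: map_f; first exact: upP.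
  exact: al_P.
- move=> z; rewrite inE negb_or => /andP[_ zxs] zav; rewrite mem_cat maskE.
  case: (boolP (lt y z)) => yltz; apply/orP; [right | left]; first exact: newP.
  by apply: map_f; apply: nb_P => //; exact: av_xs.
- move=> z; rewrite inE negb_or => /andP[_ zxs] zm zav; rewrite mem_cat maskE.
  case: (boolP (lt y z)) => yltz; apply/orP; [right | left]; first exact: newP.
  apply: map_f; apply: Hy; rewrite avE zxs zm; apply/forallP => w; apply/implyP; exact: av_xs.
Qed.

End SearchSound.

(** If [a] were the only maximal point, a point maximal among the others would have only [a] above
    it and be an up beat point. *)
Lemma two_maximal (T : finType) (lt : rel T) : irreflexive lt -> transitive lt ->
  (forall a b, lt a b -> exists c, [/\ lt a c, c != b & ~~ lt b c]) ->
  1 < #|T| -> 1 < #|maximal lt|.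
Proof.
move=> lt_irr lt_trans no_up T2.
have extreme (P : pred T) x0 : P x0 -> exists2 x, P x & forall y, lt x y -> ~~ P y.
  move=> Px0; have [x Px xmin] := @arg_minnP _ x0 P (fun x => #|[pred w | lt x w]|) Px0.
  exists x => // y xy; apply: contraL isT => /xmin; rewrite leqNgt => /negP[].
  apply: proper_card; apply/fintype.properP; split.
    by apply/fintype.subsetP => w; rewrite !inE; exact: lt_trans.
  by exists y; rewrite !inE // lt_irr.
have /card_gt0P[x0 _] : 0 < #|T| by exact: ltnW.
have [a _ amax] := @extreme predT x0 isT.
have ma : maximal lt a by apply/forallP => y; apply/negP => /amax.
rewrite ltnNge; apply/negP => /card_le1_eqP m1.
have [b0 b0a] : exists b0, b0 != a.
  have /card_gt1P[b [c [_ _ bc]]] := T2.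
  have [ba|] := eqVneq b a; last by exists b.
  by exists c; rewrite -ba eq_sym.
have [b ba bmin] := @extreme (predC1 a) b0 b0a.
have ba_lt c : lt b c -> c = a by move/bmin; rewrite /= negbK => /eqP.
have /nonmaximalP[d bd] : ~~ maximal lt b.
  by apply: contraNN ba => mb; apply/eqP; apply: m1.
have [c [bc cd _]] := no_up _ _ bd.
by rewrite (ba_lt _ bc) (ba_lt _ bd) eqxx in cd.
Qed.

(** * Classification of acyclic posets without beat points *)

Section MinimalAcyclic.
Variables (T : finType) (lt : rel T).
Hypotheses (lt_irr : irreflexive lt) (lt_trans : transitive lt) (ac : acyclic lt).
Hypothesis no_up : forall a b, lt a b -> exists c, [/\ lt a c, c != b & ~~ lt b c].
Hypothesis no_down : forall a b, lt b a -> exists c, [/\ lt c a, c != b & ~~ lt c b].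
Hypotheses (T_gt1 : 1 < #|T|) (T_le9 : #|T| <= 9).

(** The indicator of an isolated point [x] is a 0-cocycle, and it takes the value 1 on the reduced
    cycle made of [x] and any other point. *)
Lemma minimal_nonmaximal x : minimal lt x -> ~~ maximal lt x.
Proof.
move=> mx; apply/negP => Mx.
have [y yx] : exists y, y != x.
  have /card_gt1P[b [c [_ _ bc]]] := T_gt1.
  have [bx|] := eqVneq b x; last by exists b.
  by exists c; rewrite -bx eq_sym.
have := ac (n := 0) (phi := pred1 [:: x]) (z := [:: [:: x]; [:: y]]).
rewrite !big_cons big_nil /= eqxx eqseq_cons (negPf yx) /= => H.
suff: true = false by []; apply: H.
  move=> [|a [|b [|]]] //= _; rewrite andbT => ab.
  rewrite !big_cons big_nil !eqseq_cons !andbT addbF.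
  have [ax|_] := eqVneq a x; first by rewrite /rgt ax minimalF in ab *.
  by have [bx|//] := eqVneq b x; rewrite /rgt bx maximalF in ab *.
by split=> // h; rewrite big_cons !big_seq1 addbb.
Qed.

Lemma antichain_rows s : all (minimal lt) s -> lt_rows lt s = antichain (size s).
Proof.
elim: s => //= x s IH /andP[mx ms]; rewrite IH //; congr (_ :: _).
by rewrite /lt_mask; elim: s {IH ms} => //= y s ->; rewrite minimalF.
Qed.

Lemma mem_all_masks s : s \in all_masks (size s).
Proof.
elim: s => //= b s IH; rewrite mem_cat.
by case: b; apply/orP; [right|left]; apply: map_f.
Qed.

Theorem minimal_acyclic_poset (x0 : T) : #|T| = 9 /\ exists p : seq T,
  [/\ uniq p, size p = 9 &
      (forall i j, i < 9 -> j < 9 -> lt (nth x0 p i) (nth x0 p j) = P_lt_code i j) \/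
      (forall i j, i < 9 -> j < 9 -> lt (nth x0 p j) (nth x0 p i) = P_lt_code i j)].
Proof.
have max2 := two_maximal lt_irr lt_trans no_up T_gt1.
have min2 : 1 < #|minimal lt|.
  apply: (@two_maximal T (fun x y => lt y x)) => // x y z yx zy.
  exact: lt_trans zy yx.
move: T_le9; set n := #|T| => n9; set l := #|minimal lt| in min2.
have ln : l + 2 <= n.
  have le : l <= #|[predC maximal lt]|.
    by apply/subset_leq_card/fintype.subsetP => x; rewrite !inE; exact: minimal_nonmaximal.
  by rewrite /n -(cardC (maximal lt)) addnC leq_add.
have : search (leafb n) l (n - l - 2).
  have /allP/(_ n) := search_all_true; rewrite mem_iota => /(_ _)/allP/(_ l); rewrite mem_iota.
  by apply; apply/andP; split; lia.
have sL : size (enum (minimal lt)) = l by rewrite -cardE.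
have mL : all (minimal lt) (enum (minimal lt)) by apply/allP => x; rewrite mem_enum.
have nbP y : y \notin enum (minimal lt) -> (forall z, lt z y -> z \in enum (minimal lt)) ->
    lt_mask lt (enum (minimal lt)) y \in [seq d <- all_masks l | 1 < count id d].
  rewrite mem_enum => my yL; rewrite mem_filter -sL -(size_map (fun x => lt x y)) mem_all_masks andbT.
  move: my; rewrite negb_forall => /existsP[z]; rewrite negbK => zy.
  have [w [wy wz _]] := no_down zy.
  rewrite count_map -size_filter; apply: leq_trans (_ : size [:: z; w] <= _) => //.
  apply: uniq_leq_size; first by rewrite /= inE eq_sym wz.
  by move=> u; rewrite !inE mem_filter => /orP[] /eqP -> /=; rewrite ?zy ?wy yL.
rewrite /search -[in antichain _]sL -antichain_rows //.
move=> /(@search_mid_sound T lt lt_irr lt_trans no_up no_down (leafb n) max2)[].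
- exact: enum_uniq.
- elim: (enum _) mL => //= x s IH /andP[_ ms]; rewrite IH // andbT; apply/allP => y ys.
  by rewrite /not_below minimalF //; exact: allP ms y ys.
- by move=> x y; rewrite mem_enum => /minimalF ->.
- by move=> x; rewrite mem_enum; exact: minimal_nonmaximal.
- by move=> x; rewrite mem_enum.
- by rewrite sL -/n; lia.
- by move=> y _; rewrite -sL -(size_map (fun x => lt x y)) mem_all_masks.
- by move=> y yL yz; exact: nbP.
- by move=> y yL _ yz; exact: nbP.
move=> ys [uys ys_lin ys_all].
have sys : size ys = n.
  by rewrite -(card_uniqP uys); apply: eq_card => x; rewrite ys_all.
rewrite /leafb -sys; case: ifP => [/(upbeat_sound lt_irr x0 uys ys_lin ys_all)[a [b [ab H]]] _|_].
  have [c [ac' cb nbc]] := no_up ab.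
  by case: (H c ac') => [e|bc]; [rewrite e eqxx in cb | rewrite bc in nbc].
case: ifP => [/(nonacyclic_sound lt_irr x0 uys ys_lin ys_all)/(_ ac) //|_].
case: ifP => // /eqnP s9 /(Pb_sound lt_irr x0 uys ys_lin s9) H.
by split.
Qed.

End MinimalAcyclic.

(** * Extension and approximation of maps *)

Local Open Scope classical_set_scope.
Local Open Scope ring_scope.

Section UniformNbhs.
Variables (R : realType) (T : pseudoMetricType R).

Lemma compact_uniform_nbhs (K O : set T) : compact K -> open O -> K `<=` O ->
  exists2 d : R, 0 < d & forall p q, K p -> ball p d q -> O q.
Proof.
move=> /compact_near_coveringP cK oO KO.
have /(_ R 0^'+ (fun d p => forall q, ball p d q -> O q)) := cK.
have H : forall x : T, K x -> \forall x' \near x & i \near 0^'+, forall q : T, ball x' i q -> O q.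
  move=> x Kx; have /nbhs_ballP[e /= e0 eO] : nbhs x O by apply: open_nbhs_nbhs; split=> //; exact: KO.
  exists (ball x (e / 2), [set d | d < e / 2]) => /=.
    split; first by apply: nbhsx_ballx; rewrite divr_gt0.
    by apply: nbhs_right_lt; rewrite divr_gt0.
  move=> [y d] /= [xy de] q yq; apply: eO.
  rewrite (splitr e); apply: ball_triangle xy _.
  by apply: le_ball yq; exact: ltW.
move=> /(_ _ H) => h.
have : \forall d \near 0^'+, 0 < d /\ (K `<=` (fun p => forall q, ball p d q -> O q)).
  by apply: filterS2 (nbhs_right_gt 0) h => d.
move=> /filter_ex[d [d0 dK]]; exists d => // p q /dK; exact.
Qed.

End UniformNbhs.

(** * A Lebesgue number argument for maps to a finite poset *)

Section Thicken.
Variables (R : realType) (T : pseudoMetricType R) (I : finType) (lt : rel I).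
Hypotheses (lt_irr : irreflexive lt) (lt_trans : transitive lt).
Let le : rel I := fun x y => (x == y) || lt x y.
Variables (M : set T) (f : T -> I).
Hypothesis cM : compact M.
Hypothesis f_cont : forall x, exists2 V, open V & forall p, M p -> V p <-> le (f p) x.

Let leI_trans : transitive le.
Proof.
move=> y x z; rewrite /le => /predU1P[->//|xy] /predU1P[<-|yz]; first by rewrite xy orbT.
by rewrite (lt_trans xy yz) orbT.
Qed.

Let leI_refl x : le x x. Proof. by rewrite /le eqxx. Qed.

Let leI_anti x y : le x y -> le y x -> x = y.
Proof.
rewrite /le => /predU1P[//|xy] /predU1P[//|yx].
by have := lt_trans xy yx; rewrite lt_irr.
Qed.

Let f_cont_ge x : exists2 V, open V & forall p, M p -> V p <-> ~~ le x (f p).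
Proof.
have /choice[V HV] : forall y, exists V : set T, open V /\ forall p, M p -> V p <-> le (f p) y.
  by move=> y; case: (f_cont y) => V oV HV; exists V.
exists (\bigcup_(y in [set y | ~~ le x y]) V y).
  by apply: bigcup_open => y _; case: (HV y).
move=> p Mp; split=> [[y /= nxy]|nx].
  by have [_ /(_ p Mp) ->] := HV y; apply: contraTN => /leI_trans H; apply: contraNN nxy; exact: H.
by exists (f p) => //=; case: (HV (f p)) => _ /(_ p Mp) ->.
Qed.

(* Nb x consists of points near which f takes values below x, and two sets Nb x,
   Nb y that come close to each other have comparable labels x and y: the sets
   Nb replace the non-Hausdorff minimal neighbourhoods in a Lebesgue number
   argument. *)
Definition thickening (A : {set I}) (e : R) (U : set T) (Nb : I -> set T) := [/\ open U,
  (forall p, M p -> f p \in A -> U p),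
  (forall p, M p -> U p -> exists2 x, x \in A & Nb x p),
  (forall x p q, x \in A -> Nb x p -> M q -> ball p e q -> le (f q) x) &
  (forall x y p q, x \in A -> y \in A -> Nb x p -> Nb y q -> ball p e q -> le x y \/ le y x)].

(** Induction on the up-set [A], removing a minimal [x]. Off the open set [U] of the rest and the
    open set where [f] is not above [x] there remains a compact [K] on which [f] is [x]; [Nb x] is a
    small neighbourhood of [K]. *)
Lemma thickeningP (A : {set I}) : (forall x y, x \in A -> le x y -> y \in A) ->
  exists (e : R) U Nb, 0 < e /\ thickening A e U Nb.
Proof.
have [k] := ubnP #|A|; elim: k A => // k IH A Ak Aup.
have [->|A0] := eqVneq A finset.set0.
  exists 1, set0, (fun=> set0); split=> //.
  by split=> [|p _|//|x p q|x y p q]; [exact: open0|rewrite finset.inE..].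
have [x xA xmin] : exists2 x, x \in A & forall y, y \in A -> le y x -> y = x.
  have /finset.set0Pn[x0 x0A] := A0.
  have [x' x'A xmin] := arg_minnP (fun x => #|[set y in A | le y x]%SET|) x0A.
  have {}x'A : x' \in A := x'A; exists x' => // y yA yx; have := xmin y yA; rewrite leqNgt => /negP H.
  have [//|nyx] := eqVneq y x'; exfalso; apply: H; apply: proper_card; apply/fintype.properP; split.
    by apply/fintype.subsetP => w; rewrite !finset.inE => /andP[-> /= /leI_trans]; apply.
  exists x'; first by rewrite !finset.inE x'A leI_refl.
  rewrite !finset.inE x'A /=; apply: contraNN nyx => xy.
  by apply/eqP; apply: leI_anti.
have [|y w|e [U [Nb [e0 [oU UA UN Nle Ncomp]]]]] := IH (finset.setD A (finset.set1 x)).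
- by rewrite (cardsD1 x) xA in Ak.
- rewrite !finset.inE => /andP[yx yA] yw; rewrite (Aup y w) // andbT.
  by apply: contraNneq yx => wx; apply/eqP; apply: xmin; rewrite -?wx.
have [V oV HV] := f_cont_ge x.
pose K := M `&` ~` (U `|` V).
have cK : compact K.
  by apply: compact_closedI => //; apply: open_closedC; exact: openU.
have fK p : K p -> f p = x.
  move=> [Mp /not_orP[nU nV]]; apply/eqP; apply: contra_notT nU => fx.
  apply: UA => //; rewrite !finset.inE fx (Aup x) //.
  by have := HV p Mp; case: (le x (f p)) => // -[_ /(_ isT)].
have [W oW HW] := f_cont x.
have [|d d0 dW] := compact_uniform_nbhs cK oW.
  by move=> p Kp; have [Mp _] := Kp; apply/HW => //; rewrite fK.
(* Halved because [Nb x] has radius [e'] and is then left by a further step of length [e']. *)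
pose e' := Num.min (d / 2) (e / 2).
have e'0 : 0 < e' by rewrite lt_min !divr_gt0.
have e'd : e' + e' <= d by rewrite [leRHS]splitr lerD // ge_min lexx.
have e'e : e' + e' <= e by rewrite [leRHS]splitr lerD // ge_min lexx orbT.
have e'e1 : e' <= e by rewrite (le_trans _ e'e) // lerDl ltW.
pose N' y := if y == x then [set q | exists2 p, K p & ball p e' q] else Nb y.
have N'x q : N' x q -> exists2 p, K p & ball p e' q by rewrite /N' eqxx.
have N'n y q : y != x -> N' y q -> Nb y q by rewrite /N' => /negPf ->.
(* A point of [Nb y] close to [Nb x] is close to a point of [K], where [f] is [x], so [Nle] compares
   [x] with [y]. *)
have xcomp y p q : y \in A -> y != x -> N' x p -> Nb y q -> ball p e' q -> le y x \/ le x y.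
  move=> yA yx /N'x[p' Kp' p'p] Nq pq; right; rewrite -(fK _ Kp').
  apply: (Nle y q p') => //; first by rewrite !finset.inE yx.
    by case: Kp'.
  by apply: ball_sym; apply: (le_ball e'e); exact: ball_triangle p'p pq.
exists e', (U `|` \bigcup_(p in K) (ball p e')°), N'; split=> //; split.
- by apply: openU => //; apply: bigcup_open => p _; exact: open_interior.
- move=> p Mp fpA; have [Up|nU] := pselect (U p); first by left.
  right; exists p; last by apply: nbhs_singleton; apply: nbhs_interior; exact: nbhsx_ballx.
  split=> // -[//|/HV]; move/(_ Mp)/negP; apply.
  have [fpx|fpx] := eqVneq (f p) x; first by rewrite fpx.
  by case: nU; apply: UA => //; rewrite !finset.inE fpx.
- move=> p Mp [Up|[q Kq /interior_subset qp]].
    by have [y] := UN p Mp Up; rewrite !finset.inE => /andP[yx yA] Ny; exists y => //; rewrite /N' (negPf yx).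
  by exists x => //; rewrite /N' eqxx; exists q.
- move=> y p q yA Ny Mq pq; have [yx|yx] := eqVneq y x.
    move: Ny; rewrite yx => /N'x[p' Kp' p'p]; apply/HW => //; apply: dW Kp' _.
    by apply: (le_ball e'd); exact: ball_triangle p'p pq.
  apply: (Nle y p) => //; [by rewrite !finset.inE yx|exact: N'n|exact: (le_ball e'e1)].
- move=> y w p q yA wA Ny Nw pq.
  have [yx|yx] := eqVneq y x; have [wx|wx] := eqVneq w x.
  + by rewrite yx wx leI_refl; left.
  + by rewrite yx in Ny *; case: (xcomp w p q wA wx Ny (N'n _ _ wx Nw) pq); [right|left].
  + by rewrite wx in Nw *; case: (xcomp y q p yA yx Nw (N'n _ _ yx Ny) (ball_sym pq)); [left|right].
  + apply: (Ncomp y w p q); rewrite ?inE ?yx ?wx //; [exact: N'n|exact: N'n|exact: (le_ball e'e1)].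
Qed.

Lemma thicken : exists (e : R) (Nb : I -> set T), [/\ 0 < e,
  (forall p, M p -> exists x, Nb x p),
  (forall x p q, Nb x p -> M q -> ball p e q -> le (f q) x) &
  (forall x y p q, Nb x p -> Nb y q -> ball p e q -> le x y \/ le y x)].
Proof.
have [//|e [U [Nb [e0 [oU UA UN Nle Ncomp]]]]] := @thickeningP (finset predT).
exists e, Nb; split=> //.
- by move=> p Mp; have [|x _] := UN p Mp; [by apply: UA => //; rewrite finset.inE | exists x].
- by move=> x p q; apply: Nle; rewrite finset.inE.
- by move=> x y p q; apply: Ncomp; rewrite finset.inE.
Qed.

End Thicken.

Lemma within_comp (S T U : topologicalType) (A : set S) (B : set T) (f : S -> T) (g : T -> U) :
  {within A, continuous f} -> (forall x, A x -> B (f x)) -> {within B, continuous g} ->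
  {within A, continuous (g \o f)}.
Proof.
move=> /subspace_continuousP cf fAB /subspace_continuousP cg; apply/subspace_continuousP => x Ax.
move=> P nP; have gP : nbhs (f x) (fun y => B y -> P (g y)) := cg _ (fAB _ Ax) P nP.
have : nbhs x (fun y => A y -> B (f y) -> P (g (f y))) := cf x Ax _ gP.
by apply: filterS => y H Ay; exact: H Ay (fAB _ Ay).
Qed.

Lemma within_eq (S T : topologicalType) (A : set S) (f g : S -> T) :
  (forall x, A x -> f x = g x) -> {within A, continuous f} -> {within A, continuous g}.
Proof. by move=> fg; apply: subspace_eq_continuous => x; rewrite inE; exact: fg. Qed.

Lemma closed_preimage (S T : topologicalType) (f : S -> T) (D : set T) :
  continuous f -> closed D -> closed (f @^-1` D).
Proof. by move=> /continuous_closedP; apply. Qed.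

Lemma closed_prod (S T : topologicalType) (D : set S) (E : set T) :
  closed D -> closed E -> closed [set z : S * T | D z.1 /\ E z.2].
Proof.
move=> cD cE; have -> : [set z : S * T | D z.1 /\ E z.2] = (fst @^-1` D) `&` (snd @^-1` E) by [].
by apply: closedI; apply: closed_preimage => // z; [exact: cvg_fst | exact: cvg_snd].
Qed.

Lemma norm_sub_continuous (R : realType) (V : normedModType R) (a : V) :
  continuous (fun s => `|s - a|).
Proof. by move=> s; apply: cvg_norm; apply: cvgB; [exact: cvg_id | exact: cvg_cst]. Qed.

Lemma continuous_pair (S T U : topologicalType) (f : S -> T) (g : S -> U) :
  continuous f -> continuous g -> continuous (fun x => (f x, g x)).
Proof. by move=> cf cg x; apply: cvg_pair; [exact: cf | exact: cg]. Qed.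

Lemma continuous_pairl (S T : topologicalType) (t : T) : continuous (fun s : S => (s, t)).
Proof. by apply: continuous_pair => s; [exact: cvg_id | exact: cvg_cst]. Qed.

Lemma continuous_maxr (R : realType) (S : topologicalType) (f g : S -> R) :
  continuous f -> continuous g -> continuous (fun x => Num.max (f x) (g x)).
Proof.
move=> cf cg x.
have -> : (fun x => Num.max (f x) (g x)) = (fun x => (f x + g x + `|f x - g x|) * 2^-1).
  by apply/funext => y; rewrite maxr_absE.
apply: cvgM; [|exact: cvg_cst]; apply: cvgD; first by apply: cvgD; [exact: cf|exact: cg].
by apply: cvg_norm; apply: cvgB; [exact: cf|exact: cg].
Qed.

(** * Extending a homotopy over a cell *)

Section Box.
Variables (R : realType) (k : nat).
Implicit Types (s : 'rV[R]_k) (t : R).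

Definition cube_center : 'rV[R]_k := const_mx (1 / 2).

Lemma mx_norm_leP (x : 'rV[R]_k) (e : R) : 0 <= e -> `|x| <= e <-> forall i, `|x 0 i| <= e.
Proof.
move=> e0; rewrite [`|x|]mx_normrE; split.
  by move/bigmax_leP => [_ H] i; exact: (H (0, i)).
by move=> H; apply/bigmax_leP; split=> // -[i j] _ /=; rewrite (ord1 i).
Qed.

Lemma cubeP s : cube s <-> `|s - cube_center| <= 1 / 2.
Proof.
rewrite mx_norm_leP //; split=> H i; have := H i; rewrite !mxE in_itv /= ler_distl.
  by move=> /andP[? ?]; apply/andP; split; lra.
by move=> /andP[? ?]; apply/andP; split; lra.
Qed.

Lemma cube_boundaryP s : cube_boundary s <-> `|s - cube_center| = 1 / 2.
Proof.
split=> [[cs [i si]]|H].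
  apply/eqP; rewrite eq_le; apply/andP; split; first exact/cubeP.
  suff -> : 1 / 2 = `|(s - cube_center) 0 i|.
    by have /(mx_norm_leP (s - cube_center) (normr_ge0 _)) := lexx `|s - cube_center|; exact.
  rewrite !mxE; case: si => ->; last by rewrite ger0_norm; lra.
  by rewrite ler0_norm; lra.
split; first by apply/cubeP; rewrite H.
have [|i] := @mx_norm_neq0 _ _ _ (s - cube_center).
  by change (`|s - cube_center| != 0); rewrite H; lra.
move=> e; exists i.2; move: e.
change (`|s - cube_center| = `|(s - cube_center) i.1 i.2| -> s 0 i.2 = 0 \/ s 0 i.2 = 1).
rewrite (ord1 i.1) H !mxE; case: (lerP 0 (s 0 i.2 - 1 / 2)) => h.
  by rewrite ger0_norm // => ?; right; lra.
by rewrite ltr0_norm // => ?; left; lra.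
Qed.

Variable T : R.
Hypothesis T_gt0 : 0 < T.

(** The first term dominates when the ray leaves through a side, the last when it leaves through the
    bottom. The constant [1 / 2] keeps the factor positive everywhere and never exceeds the last
    term at times up to [T]. *)
Definition box_scale (x : 'rV[R]_k * R) : R :=
  Num.max (`|x.1 - cube_center| * 2) (Num.max (1 / 2) (1 - x.2 / (2 * T))).

(* Radial projection from the point (cube_center, 2T) of the prism cube * [0, T] onto
   its bottom and sides. *)
Definition box_retract (x : 'rV[R]_k * R) : 'rV[R]_k * R :=
  (cube_center + (box_scale x)^-1 *: (x.1 - cube_center), 2 * T - (2 * T - x.2) / box_scale x).

Lemma box_scale_gt0 x : 0 < box_scale x.
Proof. by rewrite /box_scale !lt_max (_ : 0 < 1 / 2) ?orbT //; lra. Qed.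

Lemma box_scale_continuous : continuous box_scale.
Proof.
apply: continuous_maxr => [x|].
  apply: cvgM; last exact: cvg_cst.
  by apply: cvg_norm; apply: cvgB; [exact: cvg_fst | exact: cvg_cst].
apply: continuous_maxr => x; first exact: cvg_cst.
apply: cvgB; first exact: cvg_cst.
by apply: cvgM; [exact: cvg_snd | exact: cvg_cst].
Qed.

Lemma box_retract_continuous : continuous box_retract.
Proof.
have cV x : (box_scale y)^-1 @[y --> x] --> (box_scale x)^-1.
  by apply: cvgV; [rewrite gt_eqF // box_scale_gt0 | exact: box_scale_continuous].
apply: continuous_pair => x.
  apply: cvgD; first exact: cvg_cst.
  by apply: cvgZ; [exact: cV | apply: cvgB; [exact: cvg_fst | exact: cvg_cst]].
apply: cvgB; first exact: cvg_cst.
apply: cvgM; last exact: cV.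
by apply: cvgB; [exact: cvg_cst | exact: cvg_snd].
Qed.

Lemma box_retract_id s t : cube_boundary s -> 0 <= t <= T -> box_retract (s, t) = (s, t).
Proof.
move=> /cube_boundaryP H /andP[t0 tT]; rewrite /box_retract.
have -> : box_scale (s, t) = 1.
  rewrite /box_scale /= H max_l; first lra.
  rewrite ge_max; apply/andP; split; first lra.
  have : 0 <= t / (2 * T) by rewrite divr_ge0 //; lra.
  lra.
by rewrite invr1 scale1r addrC subrK mulr1 /=; congr (_, _); lra.
Qed.

Lemma box_retract_bottom s : cube s -> box_retract (s, 0) = (s, 0).
Proof.
move=> /cubeP cs; rewrite /box_retract.
have -> : box_scale (s, 0) = 1.
  by rewrite /box_scale /= mul0r subr0 [X in Num.max _ X]max_r ?max_r //; lra.
by rewrite invr1 scale1r addrC subrK mulr1 /=; congr (_, _); lra.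
Qed.

Lemma box_retractP s t : cube s -> 0 <= t <= T ->
  let y := box_retract (s, t) in
  [/\ cube y.1, 0 <= y.2 & y.2 <= 0 \/ cube_boundary y.1].
Proof.
move=> /cubeP cs /andP[t0 tT] y.
have c0 := box_scale_gt0 (s, t); set c := box_scale (s, t) in c0.
have cn : `|s - cube_center| * 2 <= c by rewrite /c /box_scale le_max lexx.
have ct : 1 - t / (2 * T) <= c by rewrite /c /box_scale !le_max lexx !orbT.
have tT2 : t / (2 * T) <= 1 / 2.
  rewrite ler_pdivrMr; last by rewrite mulr_gt0. rewrite mulrA mul1r mulVf ?mul1r //.
have y1 : `|y.1 - cube_center| = c^-1 * `|s - cube_center|.
  by rewrite /y /= addrC addKr normrZ gtr0_norm // invr_gt0.
split.
- by apply/cubeP; rewrite y1 ler_pdivrMl //; lra.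
- rewrite /y /= subr_ge0 ler_pdivrMr //.
  have : (1 - t / (2 * T)) * (2 * T) <= c * (2 * T) by apply: ler_wpM2r => //; lra.
  by rewrite mulrBl divfK ?mul1r 1?[c * _]mulrC // lt0r_neq0 // mulr_gt0.
- have [e|e] : c = `|s - cube_center| * 2 \/ c = 1 - t / (2 * T).
    rewrite /c /box_scale /=.
    case: (leP (`|s - cube_center| * 2) (Num.max (1 / 2) (1 - t / (2 * T)))) => h; last by left.
    by right; rewrite max_r //; lra.
  + right; apply/cube_boundaryP; rewrite y1 e invfM mulrAC mulVf ?mul1r; first lra.
    by apply: contra_neq (lt0r_neq0 c0) => n0; rewrite e n0 mul0r.
  + left; rewrite /y /= -/c subr_le0 ler_pdivlMr // e mulrBr mulr1 [_ * (t / _)]mulrC divfK //.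
    by rewrite lt0r_neq0 // mulr_gt0.
Qed.

End Box.

Lemma cst_based_cube_map (R : realType) (X : topologicalType) k (x : X) :
  based_cube_map x (cst x : 'rV[R]_k -> X).
Proof. by split=> //; exact: continuous_subspaceT (@cst_continuous _ _ _). Qed.

(** In positive dimension the class of [f] is that of the constant map, hence contains it. The cube
    of dimension 0 is a point without boundary, and a path to [x] does. *)
Lemma null_homotopy (R : realType) (X : topologicalType) (x : X) k (f : 'rV[R]_k -> X) :
  homotopically_trivial R X -> based_cube_map x f ->
  homotopic_rel R (@cube R k) (@cube_boundary R k) f (cst x).
Proof.
move=> [_ pc pi_trivial]; case: k f => [|k] f bf; last first.
  have : homotopy_class x f = homotopy_class x (cst x).
    have : homotopy_group x (homotopy_class x f) by exists f.
    by rewrite pi_trivial.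
  move=> /(congr1 (@^~ (cst x))) e.
  suff : homotopy_class x f (cst x) by case.
  rewrite e; split; first exact: cst_based_cube_map.
  exists (cst x); split=> //; exact: continuous_subspaceT (@cst_continuous _ _ _).
have [p [cp p0 p1]] := pc (f 0) x.
exists (p \o snd); split.
- apply: (within_comp _ _ cp); last by move=> z [].
  by apply: continuous_subspaceT => z; exact: cvg_snd.
- by move=> s _ /=; rewrite p0; congr f; apply/rowP => -[].
- by move=> s _ /=; rewrite p1.
- by move=> s t [_ [[]]].
Qed.

Lemma cube_compact (R : realType) k : compact (@cube R k).
Proof.
rewrite (_ : @cube R k = [set s : 'rV[R]_k | forall i, `[0, 1]%classic (s ord0 i)]) //.
by apply: (@rV_compact R k (fun=> `[0, 1]%classic)) => _; exact: segment_compact.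
Qed.

Section ExtendCell.
Variables (R : realType) (X : topologicalType) (x0 : X) (k m : nat).
Variables (A : set 'rV[R]_m) (h : 'rV[R]_k -> 'rV[R]_m) (g : 'rV[R]_m -> 'rV[R]_k).
Variables (e : 'rV[R]_m -> X) (G : 'rV[R]_m * R -> X) (T : R).
Let C := h @` @cube R k.
Hypotheses (htX : homotopically_trivial R X) (cA : closed A).
Hypotheses (ch : continuous h) (cg : continuous g).
Hypothesis hK : forall s, cube s -> g (h s) = s.
Hypothesis A_cell : forall s, cube s -> A (h s) <-> cube_boundary s.
Hypothesis ce : {within C, continuous e}.
Hypothesis T0 : 0 < T.
Hypothesis cG : {within [set z | A z.1 /\ 0 <= z.2], continuous G}.
Hypothesis G0 : forall p, A p -> G (p, 0) = e p.
Hypothesis GT : forall p t, A p -> T <= t -> G (p, t) = x0.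

Let cube_closed : closed (@cube R k).
Proof.
have -> : @cube R k = (fun s => `|s - cube_center R k|) @^-1` [set y | y <= 1 / 2].
  by apply/seteqP; split=> s /cubeP.
by apply: closed_preimage; [exact: norm_sub_continuous | exact (@closed_le _ _)].
Qed.

Let boundary_closed : closed (@cube_boundary R k).
Proof.
have -> : @cube_boundary R k = (fun s => `|s - cube_center R k|) @^-1` [set y | y = 1 / 2].
  by apply/seteqP; split=> s /cube_boundaryP.
by apply: closed_preimage; [exact: norm_sub_continuous | exact (@closed_eq _ _)].
Qed.

Let C_closed : closed C.
Proof.
apply: compact_closed; first exact: norm_hausdorff.
apply: continuous_compact; last exact: cube_compact.
exact: continuous_subspaceT.
Qed.

Let strip (B : set 'rV[R]_k) (a b : R) := [set z : 'rV[R]_k * R | B z.1 /\ a <= z.2 <= b].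

Let b (z : 'rV[R]_k * R) : X := if z.2 <= 0 then e (h z.1) else G (h z.1, z.2).

Let bottom := [set z : 'rV[R]_k * R | cube z.1 /\ z.2 = 0].
Let sides := [set z : 'rV[R]_k * R | cube_boundary z.1 /\ 0 <= z.2].

Let b_continuous : {within bottom `|` sides, continuous b}.
Proof.
apply: withinU_continuous.
- by apply: (@closed_prod _ _ _ [set 0]) => //; exact (@closed_eq _ _).
- by apply: (@closed_prod _ _ _ [set y : R | 0 <= y]) => //; exact (@closed_ge _ _).
- apply: (@within_eq _ _ _ (e \o (h \o fst))); first by move=> z [_ z0]; rewrite /b z0 lexx.
  apply: (@within_comp _ _ _ _ C) => //; last by move=> z [cz _]; exists z.1.
  by apply: continuous_subspaceT => z; apply: continuous_comp; [exact: cvg_fst | exact: ch].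
- apply: (@within_eq _ _ _ (G \o (fun z => (h z.1, z.2)))).
    move=> z [bz z0] /=; rewrite /b; case: ifPn => // z0'.
    have -> : z.2 = 0 by apply/eqP; rewrite eq_le z0'.
    by rewrite G0 //; apply/A_cell => //; case: bz.
  apply: (within_comp _ _ cG); last first.
    by move=> z [bz z0]; split=> //=; apply/A_cell => //; case: bz.
  apply: continuous_subspaceT; apply: continuous_pair => z; last exact: cvg_snd.
  by apply: continuous_comp; [exact: cvg_fst | exact: ch].
Qed.

Let B (z : 'rV[R]_k * R) : X := b (box_retract T z).

Let B_continuous : {within strip (@cube R k) 0 T, continuous B}.
Proof.
apply: within_comp b_continuous; first exact/continuous_subspaceT/box_retract_continuous.
move=> [s t] [/= cs tT]; have [cy y0 [y0'|by_]] := box_retractP T0 cs tT; last by right.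
by left; split=> //; apply/eqP; rewrite eq_le y0'.
Qed.

Let B_boundary s t : cube_boundary s -> 0 <= t <= T -> B (s, t) = G (h s, t).
Proof.
move=> bs tT; rewrite /B box_retract_id // /b /=; case: ifPn => // t0.
have -> : t = 0 by apply/eqP; rewrite eq_le t0; case/andP: tT.
by rewrite G0 //; apply/A_cell => //; case: bs.
Qed.

(* The retraction extends the map over [0, T]; the resulting map at time T is
   constant on the boundary of the cell, hence null homotopic in time 1. *)
Lemma extend_cell : exists G' : 'rV[R]_m * R -> X,
  [/\ {within [set z | (A `|` C) z.1 /\ 0 <= z.2], continuous G'},
      (forall p, (A `|` C) p -> G' (p, 0) = e p) &
      (forall p t, (A `|` C) p -> T + 1 <= t -> G' (p, t) = x0)].
Proof.
pose f1 s := B (s, T).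
have TT : 0 <= T <= T by rewrite lexx ltW.
have bf1 : based_cube_map x0 f1.
  split=> [|s bs]; last first.
    by rewrite /f1 B_boundary // GT //; apply/A_cell => //; case: bs.
  apply: (@within_comp _ _ _ _ (strip (@cube R k) 0 T) (fun s => (s, T))) => //.
  exact/continuous_subspaceT/continuous_pairl.
have [H [cH H0 H1 Hb]] := null_homotopy htX bf1.
(* On the new cell: the retraction until [T], the null homotopy for one unit of time, then [x0].
   After [T] all this is [x0] on the boundary, in agreement with [G]. *)
pose G' z := if `[< A z.1 >] then G z else if z.2 <= T then B (g z.1, z.2)
  else if z.2 <= T + 1 then H (g z.1, z.2 - T) else x0.
have G'A p t : A p -> G' (p, t) = G (p, t) by move=> Ap; rewrite /G' /= asboolT.
have G'1 s t : cube s -> 0 <= t <= T -> G' (h s, t) = B (s, t).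
  move=> cs tT; rewrite /G' /=; case: asboolP => [/A_cell bs|_].
    by rewrite B_boundary //; exact: bs.
  by have /andP[_ ->] := tT; rewrite hK.
have G'2 s t : cube s -> T <= t <= T + 1 -> G' (h s, t) = H (s, t - T).
  move=> cs /andP[tT tT1].
  have tI : t - T \in `[0, 1] by rewrite in_itv /=; apply/andP; split; lra.
  rewrite /G' /=; case: asboolP => [As|_].
    have bs := (A_cell cs).1 As; rewrite GT // Hb //.
    by have [_ ->] := bf1.
  rewrite leNgt; case: ltP => [tT'|tT'] /=.
    by rewrite tT1 hK.
  have -> : t = T by apply/eqP; rewrite eq_le tT'.
  by rewrite hK // subrr H0.
have G'3 s t : cube s -> T + 1 <= t -> G' (h s, t) = x0.
  move=> cs tT; rewrite /G' /=; case: asboolP => [As|_]; first by rewrite GT //; lra.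
  rewrite hK //; case: ifPn => [?|_]; first by exfalso; lra.
  case: ifPn => // tT'; have -> : t = T + 1 by apply/eqP; rewrite eq_le tT'.
  by rewrite addrAC subrr add0r H1.
exists G'; split; first last.
- move=> p t [Ap|[s cs <-]] tT; last exact: G'3.
  by rewrite G'A // GT //; lra.
- move=> p [Ap|[s cs <-]]; first by rewrite G'A // G0.
  by rewrite G'1 ?lexx ?(ltW T0) // /B box_retract_bottom // /b /= lexx.
have -> : [set z | (A `|` C) z.1 /\ 0 <= z.2] = [set z | A z.1 /\ 0 <= z.2] `|`
  ([set z | C z.1 /\ 0 <= z.2 <= T] `|`
  ([set z | C z.1 /\ T <= z.2 <= T + 1] `|` [set z | C z.1 /\ T + 1 <= z.2])).
  apply/seteqP; split=> -[p t] /=.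
    move=> [[Ap|Cp] t0]; [by left|right].
    case: (leP t T) => tT; [by left; rewrite t0|right].
    by case: (leP t (T + 1)) => tT1; [left; rewrite ltW|right; rewrite ltW].
  by move=> [[Ap t0]|[[Cp /andP[t0 _]]|[[Cp /andP[Tt _]]|[Cp Tt]]]];
    split; by [left | right | lra].
have citv (a c : R) : closed [set y | a <= y <= c].
  by rewrite -[X in closed X]/([set` `[a, c]]); exact: itv_closed.
have cgz (D : set 'rV[R]_m) (E : set R) (a : R) : {within [set z : 'rV[R]_m * R | D z.1 /\ E z.2],
    continuous (fun z => (g z.1, z.2 - a))}.
  apply: continuous_subspaceT; apply: continuous_pair => z.
    by apply: continuous_comp; [exact: cvg_fst | exact: cg].
  by apply: cvgB; [exact: cvg_snd | exact: cvg_cst].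
apply: withinU_continuous.
- by apply: (@closed_prod _ _ _ [set y : R | 0 <= y]) => //; exact (@closed_ge _ _).
- apply: closedU; first exact: (@closed_prod _ _ _ [set y : R | 0 <= y <= T]).
  apply: closedU; first exact: (@closed_prod _ _ _ [set y : R | T <= y <= T + 1]).
  by apply: (@closed_prod _ _ _ [set y : R | T + 1 <= y]) => //; exact (@closed_ge _ _).
- by apply: within_eq cG => -[p t] [Ap _]; rewrite G'A.
apply: withinU_continuous; [exact: (@closed_prod _ _ _ [set y : R | 0 <= y <= T])| | |].
- apply: closedU; first exact: (@closed_prod _ _ _ [set y : R | T <= y <= T + 1]).
  by apply: (@closed_prod _ _ _ [set y : R | T + 1 <= y]) => //; exact (@closed_ge _ _).
- apply: (@within_eq _ _ _ (B \o (fun z => (g z.1, z.2 - 0)))).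
    by move=> [p t] [/= [s cs <-] tT]; rewrite hK // subr0 G'1.
  apply: (within_comp (cgz C [set y | 0 <= y <= T] 0) _ B_continuous).
  by move=> [p t] [/= [s cs <-] tT]; split; rewrite /= ?hK ?subr0.
apply: withinU_continuous.
- exact: (@closed_prod _ _ _ [set y : R | T <= y <= T + 1]).
- by apply: (@closed_prod _ _ _ [set y : R | T + 1 <= y]) => //; exact (@closed_ge _ _).
- apply: (@within_eq _ _ _ (H \o (fun z => (g z.1, z.2 - T)))).
    by move=> [p t] [/= [s cs <-] tT]; rewrite hK // G'2.
  apply: (within_comp (cgz C [set y | T <= y <= T + 1] T) _ cH).
  move=> [p t] [/= [s cs <-] /andP[tT tT1]]; split; rewrite /= ?hK //.
  by rewrite in_itv /=; apply/andP; split; lra.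
- apply: (@within_eq _ _ _ (cst x0)); last exact: continuous_subspaceT (@cst_continuous _ _ _).
  by move=> [p t] [/= [s cs <-] tT]; rewrite G'3.
Qed.

End ExtendCell.

Lemma continuous_rV (R : realType) (S : topologicalType) m (f : S -> 'rV[R]_m) :
  (forall x, continuous (fun s => f s 0 x)) -> continuous f.
Proof.
move=> cf s; apply/cvg_ballP => e e0.
have : \forall s' \near s, forall x, ball (f s 0 x) e (f s' 0 x).
  apply: filter_forall => x.
  have /cvg_ballP/(_ e e0) := cf x s; exact.
apply: filterS => s' H; split=> // i x; rewrite (ord1 i); exact: H.
Qed.

(** * Cubical realization of the order complex and its null homotopy *)

Section Complex.
Variables (R : realType) (m : nat) (lt : rel 'I_m).
Hypotheses (lt_irr : irreflexive lt) (lt_trans : transitive lt).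
Notation ge := (rge lt).
Local Notation cell := ({set 'I_m} * {set 'I_m})%type.
Implicit Types (p : 'rV[R]_m) (c : cell).

Definition ones p : {set 'I_m} := finset (fun x => p 0 x == 1).
Definition supp p : {set 'I_m} := finset (fun x => p 0 x != 0).

Definition chain (s : {set 'I_m}) := forall x y, x \in s -> y \in s -> ge x y \/ ge y x.

(* The face of the unit cube where the coordinates in c.1 are 1 and those
   outside c.2 are 0. *)
Definition face c : set 'rV[R]_m :=
  [set p | cube p /\ (c.1 \subset ones p) /\ (supp p \subset c.2)].

Definition valid c := [/\ c.1 != finset.set0, c.1 \subset c.2 & chain c.2].

(* The order complex of lt is the boundary part {max = 1} of the union of the
   faces of the unit cube spanned by chains. *)
Definition order_complex : set 'rV[R]_m :=
  [set p | [/\ cube p, ones p != finset.set0 & chain (supp p)]].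

Lemma onesE p x : (x \in ones p) = (p 0 x == 1). Proof. by rewrite finset.inE. Qed.
Lemma suppE p x : (x \in supp p) = (p 0 x != 0). Proof. by rewrite finset.inE. Qed.

Lemma ones_supp p : ones p \subset supp p.
Proof. by apply/fintype.subsetP => x; rewrite onesE suppE => /eqP ->; exact: oner_neq0. Qed.

Lemma face_self p : cube p -> face (ones p, supp p) p.
Proof. by move=> cp; split=> //; split=> /=. Qed.

Lemma coord_closed x (D : set R) : closed D -> closed [set p : 'rV[R]_m | D (p 0 x)].
Proof. by move=> cD; apply: (closed_preimage (@coord_continuous _ _ _ _ _)). Qed.

Lemma closed_imply (T : topologicalType) (b : bool) (A : set T) :
  closed A -> closed [set p | b -> A p].
Proof.
move=> cA; case: b; last by rewrite (_ : mkset _ = setT); [exact: closedT | apply/seteqP; split].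
by rewrite (_ : mkset _ = A) //; apply/seteqP; split=> p /= => [/(_ isT)|].
Qed.

Lemma face_closed c : closed (face c).
Proof.
have -> : face c = \bigcap_(x in [set: 'I_m]) ([set p | 0 <= p 0 x <= 1] `&`
   ([set p | x \in c.1 -> p 0 x = 1] `&` [set p | x \notin c.2 -> p 0 x = 0])).
  apply/seteqP; split=> [p [cp [/fintype.subsetP sp1 /fintype.subsetP sp2]] x _|p H].
    split; first by have := cp x; rewrite in_itv.
    split; first by move=> /sp1; rewrite onesE => /eqP.
    by apply: contraNeq => px; apply: sp2; rewrite suppE.
  split; first by move=> x; have [h _] := H x I; rewrite in_itv.
  split; apply/fintype.subsetP => x; have [_ [h1 h2]] := H x I; first by rewrite onesE => /h1/eqP.
  by rewrite suppE; apply: contraNT => /h2/eqP.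
apply: closed_bigI => x _; apply: closedI.
  apply: (@coord_closed x [set y | 0 <= y <= 1]).
  by rewrite -[X in closed X]/([set` `[0, 1]]); exact: itv_closed.
apply: closedI; apply: closed_imply.
  by apply: (@coord_closed x [set 1]); exact (@closed_eq _ _).
by apply: (@coord_closed x [set 0]); exact (@closed_eq _ _).
Qed.

Section Param.
Variables (c : cell).
Hypothesis vc : valid c.
Let D := finset.setD c.2 c.1.
Let k := #|D|.

Definition face_param (s : 'rV[R]_k) : 'rV[R]_m :=
  \row_x (if [pick j : 'I_k | enum_val j == x] is Some j then s 0 j else (x \in c.1)%:R).

Definition face_coord p : 'rV[R]_k := \row_j p 0 (enum_val j).

Lemma face_param_continuous : continuous face_param.
Proof.
apply: continuous_rV => x; under eq_fun do rewrite mxE.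
by case: pickP => [j _|_]; [exact: coord_continuous | exact: cst_continuous].
Qed.

Lemma face_coord_continuous : continuous face_coord.
Proof. by apply: continuous_rV => j; under eq_fun do rewrite mxE; exact: coord_continuous. Qed.

Lemma face_param_val s j : face_param s 0 (enum_val j) = s 0 j.
Proof.
rewrite mxE; case: pickP => [i /eqP/enum_val_inj -> //|/(_ j)]; by rewrite eqxx.
Qed.

Lemma face_param_out s x : x \notin D -> face_param s 0 x = (x \in c.1)%:R.
Proof.
rewrite mxE; case: pickP => [j /eqP <-|//]; by rewrite enum_valP.
Qed.

Lemma face_paramK s : face_coord (face_param s) = s.
Proof. by apply/rowP => j; rewrite mxE face_param_val. Qed.

Lemma face_paramP s : cube s -> face c (face_param s).
Proof.
move=> cs; have [_ /fintype.subsetP c12 _] := vc.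
split.
  move=> x; have [xD|xD] := boolP (x \in D); last first.
    by rewrite face_param_out // in_itv /=; case: (_ \in _); rewrite ?lexx ler01.
  have -> : x = enum_val (enum_rank_in xD x) by rewrite enum_rankK_in.
  by rewrite face_param_val; exact: cs.
split; apply/fintype.subsetP => x.
  by move=> xc; rewrite onesE face_param_out ?xc // finset.inE xc.
rewrite suppE; apply: contraNT => xc; rewrite face_param_out.
  by apply/eqP; rewrite (contraNF (c12 x) xc).
by rewrite finset.inE (negPf xc) andbF.
Qed.

Lemma face_paramE : face c = face_param @` @cube R k.
Proof.
apply/seteqP; split=> [p [cp [/fintype.subsetP p1 /fintype.subsetP p2]]|_ [s cs <-]]; last exact: face_paramP.
exists (face_coord p); first by move=> j; rewrite mxE; exact: cp.
apply/rowP => x; have [xD|xD] := boolP (x \in D).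
  have -> : x = enum_val (enum_rank_in xD x) by rewrite enum_rankK_in.
  by rewrite face_param_val mxE.
rewrite face_param_out //; move: xD; rewrite finset.inE negb_and negbK.
have [xc|xc] := boolP (x \in c.1) => /=; first by have := p1 x xc; rewrite onesE => /eqP ->.
by move=> xc2; apply/esym/eqP; apply: contraNT xc2 => px; apply: p2; rewrite suppE.
Qed.

(** A free coordinate becomes 0 or 1 exactly when the point leaves the full support or gains a one,
    that is when its own smallest face is a proper face of [c]. *)
Lemma face_param_boundary s : cube s ->
  cube_boundary s <-> (ones (face_param s), supp (face_param s)) <> c.
Proof.
move=> cs; have [_ /fintype.subsetP c12 _] := vc.
have [_ [/fintype.subsetP s1 /fintype.subsetP s2]] := face_paramP cs.
split=> [[_ [j sj]] e|ne].
  have := enum_valP j; rewrite finset.inE -e /= onesE suppE face_param_val.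
  by case: sj => ->; rewrite eqxx ?andbF.
split=> //; apply: contra_notP ne => /forallNP nb; rewrite [RHS]surjective_pairing.
congr (_, _); apply/finset.setP => x.
  apply/idP/idP => [xo|/s1 //].
  apply: contraTT xo => xc; rewrite onesE; have [xD|xD] := boolP (x \in D); last first.
    by rewrite face_param_out // (negPf xc) eq_sym oner_eq0.
  rewrite -(enum_rankK_in xD xD) face_param_val; apply/eqP => e.
  by have := nb (enum_rank_in xD x); rewrite e; case; right.
apply/idP/idP => [/s2 //|xc].
have [xD|xD] := boolP (x \in D); last first.
  move: xD; rewrite finset.inE xc andbT negbK => xc1; rewrite suppE.
  by rewrite face_param_out ?finset.inE ?xc1 // oner_eq0.
rewrite suppE -(enum_rankK_in xD xD) face_param_val; apply/eqP => e.
by have := nb (enum_rank_in xD x); rewrite e; case; left.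
Qed.

End Param.
End Complex.

Lemma finite_chain_max (I : finType) (lt : rel I) (P : I -> Prop) :
  irreflexive lt -> transitive lt -> (exists x, P x) ->
  (forall x y, P x -> P y -> rge lt x y \/ rge lt y x) ->
  exists2 x, P x & forall y, P y -> rge lt x y.
Proof.
move=> lt_irr lt_trans [x0 Px0] Pchain.
have {}Px0 : `[< P x0 >] by apply/asboolP.
have [x /asboolP Px xmax] :=
  @arg_maxnP _ x0 (fun x => `[< P x >]) (fun x => #|finset (fun y => lt y x)|) Px0.
exists x => // y Py; have [//|] := Pchain x y Px Py; rewrite {1}/rge => /orP[/eqP ->|xy].
  by rewrite /rge eqxx.
have := xmax y (asboolT Py); rewrite /geq /= leqNgt => /negP[].
apply: proper_card; apply/fintype.properP; split.
  by apply/fintype.subsetP => w; rewrite !finset.inE => /lt_trans; apply.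
by exists x; rewrite finset.inE // lt_irr.
Qed.

Section OrderComplex.
Variables (R : realType) (X : topologicalType) (m : nat) (lt : rel 'I_m) (x1 : 'I_m).
Hypotheses (lt_irr : irreflexive lt) (lt_trans : transitive lt).
Notation ge := (rge lt).
Local Notation cell := ({set 'I_m} * {set 'I_m})%type.
Implicit Types (p : 'rV[R]_m) (c : cell).
Hypothesis htX : homotopically_trivial R X.
Variables (inc : 'I_m -> X) (ret : X -> 'I_m).
Hypothesis incK : cancel inc ret.
Hypothesis inc_mono : forall x y U, open U -> lt x y -> U (inc y) -> U (inc x).
Hypothesis ret_cont : forall x, open [set q | ge x (ret q)].

Definition top_one p : 'I_m :=
  if [pick x | (x \in ones p) && [forall y, (y \in ones p) ==> ge x y]] is Some x then x else x1.

Lemma top_oneP p : order_complex lt p ->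
  top_one p \in ones p /\ forall y, y \in ones p -> ge (top_one p) y.
Proof.
move=> [cp /finset.set0Pn[x0 px0] ch]; rewrite /top_one; case: pickP => [x /andP[px /forallP H]|H].
  by split=> // y; apply/implyP.
have [||x px xmax] := @finite_chain_max _ lt (fun x => x \in ones p) lt_irr lt_trans.
- by exists x0.
- by move=> x y /(fintype.subsetP (ones_supp p)) ? /(fintype.subsetP (ones_supp p)) ?; exact: ch.
have := H x; rewrite px => /negP[]; apply/forallP => y; apply/implyP; exact: xmax.
Qed.

Let e p : X := inc (top_one p).

(** Closed sets are stable upwards, so [D] contains the largest vertex of weight 1 once it contains
    any of them: the preimage is a finite union of sets where a coordinate equals 1. *)
Lemma inc_top_one_continuous : {within order_complex lt, continuous e}.
Proof.
apply/continuous_closedP => D cD; apply/closed_subspaceP.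
exists (\bigcup_(y in [set y | D (inc y)]) [set p : 'rV[R]_m | [set 1] (p 0 y)]).
  apply: closed_bigcup; first exact: finite_finset.
  by move=> y _; apply: coord_closed; exact (@closed_eq _ _).
apply/seteqP; split=> p [].
  move=> [y /= Dy py] Kp; split=> //; change (D (inc (top_one p))).
  have [_ /(_ y)] := top_oneP Kp; rewrite onesE py eqxx => /(_ isT).
  rewrite /rge => /predU1P[ty|]; [by rewrite ty | rewrite /rgt => yt].
  apply: contrapT => nD; have oD : open (~` D) by exact: closed_openC.
  exact: (inc_mono oD yt nD).
move=> Dp Kp; split=> //; exists (top_one p) => //=.
by have [+ _] := top_oneP Kp; rewrite onesE => /eqP.
Qed.

Definition faces_of (Q : {set cell}) : set 'rV[R]_m := [set p | exists2 c, c \in Q & face c p].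

Lemma faces_of_closed Q : closed (faces_of Q).
Proof.
have -> : faces_of Q = \bigcup_(c in [set c | c \in Q]) face c.
  by apply/seteqP; split=> p [c cQ fp]; exists c.
by apply: closed_bigcup; [exact: finite_finset | move=> c _; exact: face_closed].
Qed.

Lemma faces_of_order_complex (Q : {set cell}) :
  (forall c, c \in Q -> valid lt c) -> faces_of Q `<=` order_complex lt.
Proof.
move=> vQ p [c /vQ[/finset.set0Pn[x xc] _ ch] [cp [/fintype.subsetP p1 /fintype.subsetP p2]]]; split=> //.
  by apply/finset.set0Pn; exists x; exact: p1.
by move=> a b /p2 ? /p2 ?; exact: ch.
Qed.

Definition face_stable (Q : {set cell}) := forall c c', c \in Q ->
  c.1 \subset c'.1 -> c'.1 \subset c'.2 -> c'.2 \subset c.2 -> c' \in Q.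

(** Induction on the number of cells: removing one of maximal dimension leaves a subcomplex that
    meets it in its boundary. Each cell takes one unit of time, starting at 1 because [extend_cell]
    wants a positive [T]. *)
Lemma extend_faces x0 (Q : {set cell}) : (forall c, c \in Q -> valid lt c) -> face_stable Q ->
  exists (G : 'rV[R]_m * R -> X) (n : nat),
  [/\ {within [set z | faces_of Q z.1 /\ 0 <= z.2], continuous G},
      (forall p, faces_of Q p -> G (p, 0) = e p) &
      (forall p t, faces_of Q p -> n.+1%:R <= t -> G (p, t) = x0)].
Proof.
have [k] := ubnP #|Q|; elim: k Q => // k IH Q Qk Qv Qs.
have [Q0|[c0' c0'Q]] := finset.set_0Vmem Q.
  exists (cst x0), 0%N; split.
  - exact: continuous_subspaceT (@cst_continuous _ _ _).
  - by move=> p [c]; rewrite Q0 finset.inE.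
  - by [].
have [c0 c0Q c0max] := @arg_maxnP _ c0' (mem Q) (fun c => #|finset.setD c.2 c.1|) c0'Q.
have {}c0Q : c0 \in Q := c0Q.
pose Q' := finset.setD Q (finset.set1 c0).
have Q'E c : (c \in Q') = (c != c0) && (c \in Q) by rewrite !finset.inE.
have Q's : face_stable Q'.
  move=> c c'; rewrite !Q'E => /andP[cc0 cQ] s1 s12 s2; rewrite (Qs c c') // andbT.
  apply: contraNneq cc0 => c'c0; rewrite c'c0 in s1 s12 s2.
  have sD : finset.setD c0.2 c0.1 \subset finset.setD c.2 c.1 by exact: finset.setDSS.
  have eD : finset.setD c0.2 c0.1 = finset.setD c.2 c.1.
    by apply/eqP; rewrite finset.eqEcard sD; exact: c0max.
  have [_ c12 _] := Qv _ cQ.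
  have es : c.1 = c0.1.
    apply/eqP; rewrite finset.eqEsubset s1; apply/fintype.subsetP => x xc0.
    have := fintype.subsetP s2 _ (fintype.subsetP s12 _ xc0) => xc2.
    have := congr1 (fun A : {set 'I_m} => x \in A) eD; rewrite !finset.inE xc0 xc2 /= andbT.
    by move/esym/negbT; rewrite negbK.
  apply/eqP; rewrite [LHS]surjective_pairing [RHS]surjective_pairing es; congr (_, _).
  apply/eqP; rewrite finset.eqEsubset s2 andbT; apply/fintype.subsetP => x xc.
  have := congr1 (fun A : {set 'I_m} => x \in A) eD; rewrite !finset.inE xc andbT es.
  have [xc0|_] := boolP (x \in c0.1); first by rewrite (fintype.subsetP s12).
  by rewrite /= => ->.
have [|| G [n [cG G0 GT]]] := IH Q' _ _ Q's.
- by rewrite (cardsD1 c0) c0Q in Qk.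
- by move=> c; rewrite Q'E => /andP[_ /Qv].
have vc := Qv _ c0Q.
have hface : face c0 = @face_param R m c0 @` @cube R _ := face_paramE R vc.
have facesQ : faces_of Q = faces_of Q' `|` @face_param R m c0 @` @cube R _.
  rewrite -hface; apply/seteqP; split=> p.
    move=> [c cQ fc]; have [cc0|cc0] := eqVneq c c0; first by right; rewrite -cc0.
    by left; exists c => //; rewrite Q'E cc0.
  by move=> [[c cQ' fc]|fc]; [exists c => //; move: cQ'; rewrite Q'E => /andP[] | exists c0].
have bd s : cube s -> faces_of Q' (@face_param R m c0 s) <-> cube_boundary s.
  move=> cs; rewrite (face_param_boundary vc cs).
  have [cp [p1 p2]] := face_paramP vc cs; split.
    move=> [c cQ' [_ [q1 q2]]] eqc; move: q1 q2.
    have -> : ones (@face_param R m c0 s) = c0.1 := congr1 fst eqc.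
    have -> : supp (@face_param R m c0 s) = c0.2 := congr1 snd eqc.
    move=> q1 q2.
    have [_ c012 _] := vc.
    by have := Q's c c0 cQ' q1 c012 q2; rewrite Q'E eqxx.
  move=> ne; exists (ones (@face_param R m c0 s), supp (@face_param R m c0 s)); last exact: face_self.
  by rewrite Q'E; apply/andP; split; [apply/eqP | apply: (Qs c0) => //=; exact: ones_supp].
have KQ : faces_of Q `<=` order_complex lt := faces_of_order_complex Qv.
have ceQ : {within @face_param R m c0 @` @cube R _, continuous e}.
  apply: continuous_subspaceW inc_top_one_continuous.
  by apply: subset_trans KQ; rewrite facesQ; exact: subsetUr.
have [|||||||||| G' [cG' G'0 G'T]] :=
  @extend_cell R X x0 _ m (faces_of Q') (@face_param R m c0) (face_coord c0) e G n.+1%:R htX.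
- exact: faces_of_closed.
- exact: face_param_continuous.
- exact: face_coord_continuous.
- by move=> s _; exact: face_paramK.
- exact: bd.
- exact: ceQ.
- by rewrite ltr0n.
- exact: cG.
- exact: G0.
- exact: GT.
exists G', n.+1; rewrite facesQ; split=> //.
by move=> p t fp tn; apply: G'T => //; rewrite -natr1 in tn.
Qed.

End OrderComplex.

(** * Monotone labels on a fine grid *)

Section Cofaces.

(** [D] is a face of [E], of any codimension. *)
Definition coface (D E : seq nat) := size D = size E /\ forall j,
  nth 0%N D j = nth 0%N E j \/
  odd (nth 0%N E j) /\ (nth 0%N D j = (nth 0%N E j).-1 \/ nth 0%N D j = (nth 0%N E j).+1).

Lemma coface_refl D : coface D D. Proof. by split=> // j; left. Qed.

Lemma coface_trans D E F : coface D E -> coface E F -> coface D F.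
Proof.
move=> [sDE DE] [sEF EF]; split; first by rewrite sDE.
move=> j; case: (EF j) => [<-//|[oF EFj]]; right; split=> //.
case: (DE j) => [->//|[oE _]]; move: oE.
case: EFj => ->; last by rewrite /= oF.
by case: (nth 0%N F j) oF => //= a /negPf ->.
Qed.

Lemma coface_facets D E : D \in facets E -> coface D E.
Proof.
move=> DE; split; first exact: size_facets DE.
have [i [iE oi Di Dj]] := facets_nth DE => j.
by have [->|/Dj ->] := eqVneq j i; [right | left].
Qed.

Lemma coface_dist (R : realType) D E j : coface D E ->
  `|(nth 0%N D j)%:R - (nth 0%N E j)%:R| <= 1 :> R.
Proof.
move=> [_ /(_ j)[->|[oE DE]]]; first by rewrite subrr normr0.
case: DE => ->; last by rewrite -natr1 addrAC subrr add0r normr1.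
case: (nth 0%N E j) oE => // a _ /=.
by rewrite -natr1 opprD addrA subrr add0r normrN normr1.
Qed.

End Cofaces.

Section Acyclic.
Variables (R : realType) (X : topologicalType) (m : nat) (lt : rel 'I_m).
Hypotheses (lt_irr : irreflexive lt) (lt_trans : transitive lt).
Hypothesis htX : homotopically_trivial R X.
Variables (inc : 'I_m -> X) (ret : X -> 'I_m).
Hypothesis incK : cancel inc ret.
Hypothesis inc_mono : forall x y U, open U -> lt x y -> U (inc y) -> U (inc x).
Hypothesis ret_cont : forall x, open [set q | rge lt x (ret q)].
Notation ge := (rge lt).

Section Grid.
Variables (x1 : 'I_m) (G : 'rV[R]_m * R -> X) (n N : nat) (Nb : 'I_m -> set ('rV[R]_m * R)).
Variable eps : R.
Let K : set 'rV[R]_m := order_complex lt.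
Let M := K `*` [set t : R | 0 <= t <= n.+1%:R].
Let f z := ret (G z).
Hypotheses (N_gt0 : (0 < N)%N) (N_eps : N%:R^-1 < eps).
Hypothesis G0 : forall p, K p -> G (p, 0) = inc (top_one lt x1 p).
Hypothesis GT : forall p t, K p -> n.+1%:R <= t -> G (p, t) = inc x1.
Hypothesis Nb_cover : forall z, M z -> exists x, Nb x z.
Hypothesis Nb_le : forall x y z, Nb x y -> M z -> ball y eps z -> ge x (f z).
Hypothesis Nb_chain : forall x y w z, Nb x w -> Nb y z -> ball w eps z -> ge x y \/ ge y x.

Let ge_refl x : ge x x. Proof. by rewrite /rge eqxx. Qed.

Let L0 := (N * n.+1)%N.

Let scale : R := (N.*2)%:R^-1.

Let scale_gt0 : 0 < scale. Proof. by rewrite invr_gt0 ltr0n double_gt0. Qed.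

Let scaleN : (N.*2)%:R * scale = 1.
Proof. by rewrite mulfV // pnatr_eq0 -lt0n double_gt0. Qed.

Definition center (D : seq nat) : 'rV[R]_m * R :=
  (\row_x ((nth 0%N D x.+1)%:R * scale), (nth 0%N D 0)%:R * scale).

Definition valid_cell D := ((head 0%N D <= L0.*2)%N /\ in_complex N lt (behead D)).

Lemma center_coord D x : (center D).1 0 x = (nth 0%N D x.+1)%:R * scale.
Proof. by rewrite mxE. Qed.

Lemma center_complex D : in_complex N lt (behead D) -> K (center D).1.
Proof.
move=> [sD DN [i Di] ch]; split.
- move=> x; rewrite center_coord in_itv /= mulr_ge0 ?ler0n ?(ltW scale_gt0) //=.
  by rewrite -[leRHS]scaleN ler_pM2r // ler_nat -nth_behead DN.
- by apply/finset.set0Pn; exists i; rewrite onesE center_coord -nth_behead Di scaleN.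
- move=> x y; rewrite !suppE !center_coord !mulf_eq0 !(gt_eqF scale_gt0) !orbF !pnatr_eq0.
  by rewrite -!nth_behead; exact: ch.
Qed.

Lemma center_valid D : valid_cell D -> M (center D).
Proof.
move=> [DL KD]; split; first exact: center_complex.
rewrite /= mulr_ge0 ?ler0n ?(ltW scale_gt0) //= nth0.
have -> : n.+1%:R = (L0.*2)%:R * scale :> R by rewrite /L0 doubleMl natrM mulrAC scaleN mul1r.
by rewrite ler_pM2r // ler_nat.
Qed.

(** Two cofaces of one cell differ by at most two codes in each coordinate, that is by [1 / N]. *)
Lemma center_ball D E F : coface D E -> coface D F -> ball (center E) eps (center F).
Proof.
move=> DE DF.
have H j : `|(nth 0%N E j)%:R * scale - (nth 0%N F j)%:R * scale| < eps.
  rewrite -mulrBl normrM (gtr0_norm scale_gt0); apply: le_lt_trans N_eps.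
  have -> : N%:R^-1 = 2 * scale :> R.
    by rewrite /scale -muln2 natrM invfM mulrCA mulfV ?mulr1 // pnatr_eq0.
  rewrite ler_pM2r //.
  have d1 := coface_dist R j DE; have d2 := coface_dist R j DF.
  rewrite -(subrK (nth 0%N D j)%:R (nth 0%N E j)%:R) -addrA.
  apply: le_trans (ler_normD _ _) _; rewrite distrC.
  by apply: le_trans (lerD d1 d2) _; rewrite -natr1.
split; last by rewrite -ball_normE; exact: H.
split; first by rewrite (le_lt_trans _ (H 0%N)).
by move=> i x; rewrite (ord1 i) !center_coord -ball_normE; exact: H.
Qed.

Definition near_labels D x := exists E, [/\ coface D E, valid_cell E & Nb x (center E)].

(** The labels seen from the cofaces of a cell are pairwise comparable, hence have a maximum. A face
    inherits the cofaces of the cell, so its maximum is at least as large: this is the monotonicity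
    required by the prism. *)
Lemma near_labels_max : {lam : seq nat -> 'I_m | forall D, valid_cell D ->
  near_labels D (lam D) /\ forall y, near_labels D y -> ge (lam D) y}.
Proof.
have /choice[lam H] : forall D, exists x : 'I_m, valid_cell D ->
  near_labels D x /\ forall y, near_labels D y -> ge x y.
  move=> D; have [vD|nvD] := pselect (valid_cell D); last by exists x1.
  have [||x Sx xmax] := @finite_chain_max _ lt (near_labels D) lt_irr lt_trans.
  - by have [x Nx] := Nb_cover (center_valid vD); exists x, D; split=> //; exact: coface_refl.
  - move=> x y [E [DE vE NE]] [F [DF vF NF]].
    by apply: (Nb_chain NE NF); exact: center_ball DE DF.
  - by exists x.
by exists lam.
Qed.

Let lam := sval near_labels_max.

Lemma lam_face D E : valid_cell D -> valid_cell E -> coface D E -> ge (lam D) (lam E).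
Proof.
rewrite /lam; case: near_labels_max => l /= H vD vE DE.
have [[F [EF vF NF]] _] := H E vE; have [_] := H D vD; apply.
by exists F; split=> //; exact: coface_trans EF.
Qed.

Lemma lam_ge D : valid_cell D -> ge (lam D) (f (center D)).
Proof.
rewrite /lam; case: near_labels_max => l /= H vD; have [[E [DE vE NE]] _] := H D vD.
by apply: (Nb_le NE); [exact: center_valid | exact: center_ball DE (coface_refl D)].
Qed.

Let bot C := top_one lt x1 (center (0%N :: C)).1.

(* An extra unit of time at either end joins lam to the labels prescribed there:
   the largest vertex of weight 1 at the bottom, the constant x1 at the top. *)
Definition grid_label t C :=
  if (t <= 1)%N then bot C else if (t <= L0.*2.+2)%N then lam (t.-2 :: C) else x1.

Lemma grid_label_lam t C : (t <= L0.*2)%N -> grid_label t.+2 C = lam (t :: C).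
Proof. by move=> tL; rewrite /grid_label /= !ltnS tL. Qed.

Lemma grid_label_top t C : (L0.*2 < t)%N -> grid_label t.+2 C = x1.
Proof. by move=> tL; rewrite /grid_label /= !ltnS leqNgt tL. Qed.

Lemma grid_acyclic : acyclic lt.
Proof.
have botP C : in_complex N lt C -> nth 0%N C (bot C) = N.*2 /\
    forall i : 'I_m, nth 0%N C i = N.*2 -> ge (bot C) i.
  move=> KC; have [bo bmax] := top_oneP x1 lt_irr lt_trans (@center_complex (0%N :: C) KC).
  have nE i : (i \in ones (center (0%N :: C)).1) = (nth 0%N C i == N.*2).
    by rewrite onesE center_coord /= -[eqbRHS]scaleN (inj_eq (mulIf (lt0r_neq0 scale_gt0))) eqr_nat.
  by split=> [|i Ci]; [apply/eqP; rewrite -nE | apply: bmax; rewrite nE Ci].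
(* At the first and last times [f] is the prescribed label, so [lam_ge] is the compatibility needed
   across the added intervals. *)
have time0 C : in_complex N lt C -> ge (lam (0%N :: C)) (bot C).
  move=> KC; have vD : valid_cell (0%N :: C) by [].
  have := lam_ge vD; rewrite /f [center _]surjective_pairing /= mul0r G0 ?incK //.
  exact: (@center_complex (0%N :: C)).
have timeT C : in_complex N lt C -> ge (lam (L0.*2 :: C)) x1.
  move=> KC; have vD : valid_cell (L0.*2 :: C) by split=> /=.
  have := lam_ge vD; rewrite /f [center _]surjective_pairing GT ?incK //.
    exact: (@center_complex (L0.*2 :: C)).
  by rewrite /= /L0 doubleMl natrM mulrAC scaleN mul1r.
move=> k phi z cphi cz.
apply: (@prism_vanish m N L0.+2 lt grid_label x1) cphi cz => //.
- move=> t C F tL KC FC; have KF := facets_in_complex KC FC.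
  rewrite /grid_label; case: ifPn => t1; first exact: (facets_lab botP KC FC).
  case: ifPn => // t2; apply: lam_face.
  + by split=> //=; move: t1 t2; case: (t) => [|[|]].
  + by split=> //=; move: t1 t2; case: (t) => [|[|]].
  + by apply: coface_facets; rewrite /= mem_cat map_f.
- move=> [|[|t]] C // ot tL KC.
    by rewrite /= grid_label_lam //; split; [exact: ge_refl | exact: time0].
  have {}ot : odd t by move: ot; rewrite /= negbK.
  have [tle|tgt] := leqP t L0.*2; last first.
    have -> : t = L0.*2.+1 by apply/eqP; rewrite eqn_leq tgt andbT -ltnS; move: tL; rewrite !doubleS !ltnS.
    by rewrite /= grid_label_lam // !grid_label_top //; split; [exact: timeT | exact: ge_refl].
  have tlt : (t < L0.*2)%N.
    by rewrite ltn_neqAle tle andbT; apply: contraTneq ot => ->; rewrite odd_double.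
  case: t ot tL tle tlt => // t ot tL tle tlt /=.
  have ot' : ~~ odd t := ot.
  rewrite !grid_label_lam ?(ltnW tle) //; split; apply: lam_face.
  + by split=> //=; exact: ltnW.
  + by split.
  + by apply: coface_facets; rewrite /= ot' mem_cat orbC /= in_cons eqxx.
  + by split.
  + by split.
  + by apply: coface_facets; rewrite /= ot' mem_cat orbC /= !in_cons eqxx orbT.
- by move=> C KC; rewrite doubleS grid_label_top.
Qed.

End Grid.

Lemma order_complex_faces : order_complex lt =
  @faces_of R m (finset (fun c : {set 'I_m} * {set 'I_m} => `[< valid lt c >])).
Proof.
apply/seteqP; split=> [p [cp op ch]|]; last first.
  by apply: faces_of_order_complex => c; rewrite finset.inE => /asboolP.
exists (ones p, supp p); last exact: face_self.
by rewrite finset.inE; apply/asboolP; split=> //=; exact: ones_supp.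
Qed.

Theorem weakly_contractible_acyclic : acyclic lt.
Proof.
move=> k phi z cphi cz.
have [x1 _|m0] := pickP 'I_m; last first.
  case: z cz => [|[|x s] z]; first by rewrite big_nil.
    by case.
  by have := m0 x.
pose Q := finset (fun c : {set 'I_m} * {set 'I_m} => `[< valid lt c >]).
have [||G [n [cG G0 GT]]] := @extend_faces R X m lt x1 lt_irr lt_trans htX inc inc_mono (inc x1) Q.
- by move=> c; rewrite finset.inE => /asboolP.
- move=> c c'; rewrite !finset.inE => /asboolP[c0 c12 ch] s1 s12 s2; apply/asboolP; split=> //.
    by apply: contraNneq c0 => e; rewrite -finset.subset0 -e.
  by move=> x y /(fintype.subsetP s2) ? /(fintype.subsetP s2) ?; exact: ch.
rewrite -order_complex_faces in cG G0 GT.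
(* Time is cut at [n.+1], where [G] has become constant, to get a compact domain. *)
pose M : set ('rV[R]_m * R) := order_complex lt `*` [set t : R | 0 <= t <= n.+1%:R].
have cM : compact M.
  apply: compact_setX.
    rewrite order_complex_faces.
    apply: (@subclosed_compact _ _ (@cube R m)); [exact: faces_of_closed | exact: cube_compact |].
    by rewrite -order_complex_faces => p [].
  rewrite (_ : mkset _ = `[0, n.+1%:R]%classic); first exact: segment_compact.
  by apply/seteqP; split=> t; rewrite /= in_itv.
have [|eps [Nb [eps0 Ncov Nle Nch]]] := @thicken R _ _ lt lt_irr lt_trans M (fun y => ret (G y)) cM.
  move=> x; have /continuousP/(_ _ (ret_cont x))/open_subspaceP[V oV HV] := cG.
  exists V => // y [Ky /andP[y0 _]].
  have yD : [set y : 'rV[R]_m * R | order_complex lt y.1 /\ 0 <= y.2] y by [].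
  rewrite eq_sym -[X in _ <-> is_true X]/(ge x (ret (G y))); split=> [Vy|gy].
    by have : (V `&` [set y | order_complex lt y.1 /\ 0 <= y.2]) y by []; rewrite HV => -[].
  have : ([set y | ge x (ret (G y))] `&` [set y | order_complex lt y.1 /\ 0 <= y.2]) y by [].
  by rewrite -[X in X y]HV => -[].
pose N := Num.bound eps^-1.
have N_eps : eps^-1 < N%:R by apply: archi_boundP; rewrite invr_ge0 ltW.
have N_gt0 : (0 < N)%N by rewrite -(ltr0n R); apply: Order.POrderTheory.lt_trans N_eps; rewrite invr_gt0.
apply: (@grid_acyclic x1 G n N Nb eps) cphi cz => //.
- by rewrite invf_plt ?posrE // ltr0n.
- by move=> x w y /Nle H /H{}H /H; rewrite eq_sym.
- move=> x y w v Nw Nv b; have := Nch x y w v Nw Nv b.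
  by rewrite /rge /rgt eq_sym [y == x]eq_sym => -[]; [right|left].
Qed.

End Acyclic.

(** * Cores of finite spaces *)

Section Homotopy.
Variables (R : realType) (X Y : topologicalType).
Implicit Types f g h : X -> Y.

Lemma homotopic_trans f g h : homotopic R f g -> homotopic R g h -> homotopic R f h.
Proof.
move=> [H [cH H0 H1 _]] [K [cK K0 K1 _]].
pose L (z : X * R) := if z.2 <= 1 / 2 then H (z.1, 2 * z.2) else K (z.1, 2 * z.2 - 1).
have LH z : z.2 <= 1 / 2 -> L z = H (z.1, 2 * z.2) by rewrite /L => ->.
have LK z : 1 / 2 <= z.2 -> L z = K (z.1, 2 * z.2 - 1).
  rewrite /L le_eqVlt => /predU1P[e|lt]; last by rewrite leNgt lt.
  rewrite -e lexx; have -> : 2 * (1 / 2) = 1 :> R by lra.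
  by rewrite subrr H1 // K0.
exists L; split=> [|x _|x _|x t []//]; last 2 first.
- by rewrite LH /=; [rewrite mulr0 H0 | lra].
- by rewrite LK /=; [rewrite mulr1 (_ : 2 - 1 = 1) ?K1 //; lra | lra].
have -> : [set: X] `*` `[0, 1] = [set z : X * R | [set: X] z.1 /\ 0 <= z.2 <= 1 / 2] `|`
    [set z | [set: X] z.1 /\ 1 / 2 <= z.2 <= 1].
  apply/seteqP; split=> -[x t] /=.
    move=> [_]; rewrite in_itv /= => /andP[t0 t1].
    by case: (leP t (1 / 2)) => ht; [left; rewrite t0 | right; rewrite ltW].
  by move=> [] [_ /andP[a b]]; split=> //; rewrite in_itv /=; apply/andP; split; lra.
have citv (a b : R) : closed [set y | a <= y <= b].
  by rewrite -[X in closed X]/([set` `[a, b]]); exact: itv_closed.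
have caff (a : R) : continuous (fun z : X * R => (z.1, 2 * z.2 - a)).
  apply: continuous_pair => z; first exact: cvg_fst.
  by apply: cvgB; [apply: cvgM; [exact: cvg_cst | exact: cvg_snd] | exact: cvg_cst].
apply: withinU_continuous.
- exact: (@closed_prod _ _ [set: X] [set y : R | 0 <= y <= 1 / 2]).
- exact: (@closed_prod _ _ [set: X] [set y : R | 1 / 2 <= y <= 1]).
- apply: (@within_eq _ _ _ (H \o (fun z => (z.1, 2 * z.2 - 0)))).
    by move=> z [_ /andP[_ ?]]; rewrite LH // /= subr0.
  apply: (within_comp _ _ cH); first exact/continuous_subspaceT/caff.
  by move=> z [_ /andP[? ?]]; split=> //=; rewrite in_itv /=; apply/andP; split; lra.
- apply: (@within_eq _ _ _ (K \o (fun z => (z.1, 2 * z.2 - 1)))).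
    by move=> z [_ /andP[? _]]; rewrite LK.
  apply: (within_comp _ _ cK); first exact/continuous_subspaceT/caff.
  by move=> z [_ /andP[? ?]]; split=> //=; rewrite in_itv /=; apply/andP; split; lra.
Qed.

(** The homotopy jumps: it is [f] on an open set of times and [g] at the remaining end. It is
    continuous since an open set containing [g x] contains [f x]. *)
Lemma homotopic_specialization f g : continuous f -> continuous g ->
  (forall x U, open U -> U (g x) -> U (f x)) -> homotopic R f g /\ homotopic R g f.
Proof.
move=> /continuousP cf /continuousP cg fg.
have cfst : continuous (@fst X R) by move=> z; exact: cvg_fst.
have csnd : continuous (@snd X R) by move=> z; exact: cvg_snd.
have of_ (U : set X) (E : set R) : open U -> open E -> open [set z : X * R | U z.1 /\ E z.2].
  move=> oU oE; have -> : [set z : X * R | U z.1 /\ E z.2] = (fst @^-1` U) `&` (snd @^-1` E) by [].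
  by apply: openI; [move/continuousP: cfst; apply | move/continuousP: csnd; apply].
split.
  exists (fun z => if z.2 < 1 then f z.1 else g z.1); split=> [|x _|x _|x t []//] /=.
  - apply: continuous_subspaceT; apply/continuousP => U oU.
    rewrite (_ : _ @^-1` _ = [set z : X * R | (f @^-1` U) z.1 /\ [set t | t < 1] z.2] `|`
      [set z : X * R | (g @^-1` U) z.1 /\ setT z.2]).
      by apply: openU; apply: of_; [exact: cf | exact: open_lt | exact: cg | exact: openT].
    apply/seteqP; split=> -[x t] /=; first by case: ifP => ? ?; [left|right].
    by case: ifP => ht [[? ?]|[? _]] //; exact: fg oU _.
  - by rewrite ltr01.
  - by rewrite ltxx.
exists (fun z => if 0 < z.2 then f z.1 else g z.1); split=> [|x _|x _|x t []//] /=.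
- apply: continuous_subspaceT; apply/continuousP => U oU.
  rewrite (_ : _ @^-1` _ = [set z : X * R | (f @^-1` U) z.1 /\ [set t | 0 < t] z.2] `|`
    [set z : X * R | (g @^-1` U) z.1 /\ setT z.2]).
    by apply: openU; apply: of_; [exact: cf | exact: open_gt | exact: cg | exact: openT].
  apply/seteqP; split=> -[x t] /=; first by case: ifP => ? ?; [left|right].
  by case: ifP => ht [[? ?]|[? _]] //; exact: fg oU _.
- by rewrite ltxx.
- by rewrite ltr01.
Qed.

End Homotopy.

Section FiniteSpace.
Variables (R : realType) (X : topologicalType) (k : nat) (e : 'I_k -> X).
Hypothesis e_surj : forall q, exists i, e i = q.

(** The order of the space; only a preorder, since [X] is not assumed T$_0$. *)
Definition specializes (p q : X) := forall U, open U -> U q -> U p.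

Lemma spec_trans p q s : specializes p q -> specializes q s -> specializes p s.
Proof. by move=> pq qs U oU Us; apply: pq => //; exact: qs. Qed.

Lemma min_open q : open [set p | specializes p q].
Proof.
have /choice[V HV] : forall i, exists V : set X, [/\ open V, V q & V (e i) -> specializes (e i) q].
  move=> i; have [s|] := pselect (specializes (e i) q); first by exists setT; split=> //; exact: openT.
  by move=> /existsNP[V /not_implyP[oV /not_implyP[Vq nV]]]; exists V; split.
have -> : [set p | specializes p q] = ~` \bigcup_(i in [set: 'I_k]) ~` V i.
  rewrite setC_bigcup; apply/seteqP; split=> [p pq i _|p Vp].
    by rewrite setCK; have [oV Vq _] := HV i; exact: pq.
  have [i ei] := e_surj p; have [_ _] := HV i; rewrite ei; apply.
  by have := Vp i I; rewrite setCK.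
apply: closed_openC; apply: closed_bigcup; first exact: finite_finset.
by move=> i _; apply: open_closedC; case: (HV i).
Qed.

Lemma down_open (U : set X) : (forall p q, specializes p q -> U q -> U p) -> open U.
Proof.
move=> dU; have -> : U = \bigcup_(q in U) [set p | specializes p q].
  apply/seteqP; split=> [p Up|p [q Uq] pq]; last exact: dU pq Uq.
  by exists p.
by apply: bigcup_open => q _; exact: min_open.
Qed.

Lemma mono_continuous (f : X -> X) : (forall p q, specializes p q -> specializes (f p) (f q)) -> continuous f.
Proof.
move=> mf; apply/continuousP => U oU; apply: down_open => p q pq; exact: mf pq U oU.
Qed.

Lemma continuous_mono (f : X -> X) : continuous f -> forall p q, specializes p q -> specializes (f p) (f q).
Proof. by move=> /continuousP cf p q pq U oU; apply: (pq (f @^-1` U) (cf U oU)). Qed.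

Definition retract m (inc : 'I_m -> X) (ret : X -> 'I_m) :=
  [/\ cancel inc ret, continuous (inc \o ret) & homotopic R (inc \o ret) idfun].

Definition lei m (inc : 'I_m -> X) x y := `[< specializes (inc x) (inc y) >].

(** Sending [b] to [a] is monotone and comparable with the identity. The hypotheses cover beat
    points as well as indistinguishable pairs, so a minimal retract is also T$_0$. *)
Lemma retract_remove m (inc : 'I_m.+1 -> X) ret (a b : 'I_m.+1) :
  retract inc ret -> a != b -> lei inc a b \/ lei inc b a ->
  (forall c, c != b -> (lei inc c b -> lei inc c a) /\ (lei inc b c -> lei inc a c)) ->
  exists (inc' : 'I_m -> X) ret', retract inc' ret'.
Proof.
move=> [incK cir hir] ab comp H.
have [j0 _ _] := unlift_some ab.
pose rho c := if c == b then a else c.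
have rhob c : rho c != b by rewrite /rho; case: ifP => // /negbT.
pose ret' p := if unlift b (rho (ret p)) is Some j then j else j0.
have lret p : lift b (ret' p) = rho (ret p).
  rewrite /ret'; case: unliftP => [j -> //|rb]; by have := rhob (ret p); rewrite rb eqxx.
have lei_refl c : lei inc c c by apply/asboolP.
have rho_mono x y : lei inc x y -> lei inc (rho x) (rho y).
  rewrite /rho; have [->|xb] := eqVneq x b; have [->|yb] := eqVneq y b => //.
  - by move=> /((H y yb).2).
  - by move=> /((H x xb).1).
have c' : continuous ((inc \o lift b) \o ret').
  apply: mono_continuous => p q pq; rewrite /= !lret; apply/asboolP; apply: rho_mono.
  by apply/asboolP; exact: (continuous_mono cir pq).
exists (inc \o lift b), ret'; split=> //.
  move=> j; apply: (@lift_inj _ b); rewrite lret /= incK /rho.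
  by rewrite eq_sym (negPf (neq_lift b j)).
apply: homotopic_trans hir.
have [cab|cba] := comp.
  have [] // := @homotopic_specialization R X X _ _ c' cir => x U oU.
  rewrite /= lret /rho; case: eqP => [->|//]; apply: (asboolP _ cab) => //.
have [] // := @homotopic_specialization R X X _ _ cir c' => x U oU.
rewrite /= lret /rho; case: eqP => [->|//]; apply: (asboolP _ cba) => //.
Qed.

Hypothesis e_inj : injective e.

Lemma retract_refl : exists (inc : 'I_k -> X) ret, retract inc ret.
Proof.
have /choice[ret retK] : forall q, exists i, e i = q by [].
exists e, ret; split.
- by move=> i; apply: e_inj; rewrite retK.
- by apply: mono_continuous => p q; rewrite /= !retK.
- exists fst; split=> [|q _|q _|q t []//] /=; rewrite ?retK //.
  by apply: continuous_subspaceT => z; exact: cvg_fst.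
Qed.

Lemma retract1_contractible (inc : 'I_1 -> X) ret : retract inc ret -> contractible R X.
Proof.
move=> [incK cir hir]; exists (fun _ => tt : discrete_topology unit), (fun _ => inc ord0); split.
- by move=> q; exact: cvg_cst.
- by move=> q; exact: cvg_cst.
- have -> // : (fun _ => inc ord0) \o (fun _ => tt : discrete_topology unit) = inc \o ret.
  by apply/funext => q /=; rewrite (ord1 (ret q)).
- exists fst; split=> [|[] //|[] //|q t []//] /=.
  by apply: continuous_subspaceT => z; exact: cvg_fst.
Qed.

Lemma core_poset : (k <= 9)%N -> homotopically_trivial R X -> ~ contractible R X ->
  k = 9%N /\ exists v : nat -> X, (forall q, exists2 i, (i < 9)%N & v i = q) /\
    ((forall i j, (i < 9)%N -> (j < 9)%N -> specializes (v i) (v j) <-> (i == j) || P_lt_code i j) \/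
     (forall i j, (i < 9)%N -> (j < 9)%N -> specializes (v j) (v i) <-> (i == j) || P_lt_code i j)).
Proof.
move=> k9 htX ncX.
pose has m := `[< exists (inc : 'I_m -> X) ret, retract inc ret >].
have hask : exists m, has m by exists k; apply/asboolP; exact: retract_refl.
case: (ex_minnP hask) => m /asboolP[inc [ret hr]] mmin.
have mk : (m <= k)%N by apply: mmin; apply/asboolP; exact: retract_refl.
have [incK cir hir] := hr.
have incI := can_inj incK.
have irred (a b : 'I_m) : a != b -> lei inc a b \/ lei inc b a ->
    exists2 c, c != b & ~ ((lei inc c b -> lei inc c a) /\ (lei inc b c -> lei inc a c)).
  case: m inc ret hr mmin mk incK cir hir incI a b => [|m] inc ret hr mmin mk incK cir hir incI a b.
    by case: a.
  move=> ab cab; apply: contrapT => nex.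
  have : has m.
    apply/asboolP; apply: (retract_remove hr ab cab) => c cb.
    by apply: contrapT => nc; apply: nex; exists c.
  by move=> /mmin; rewrite ltnn.
have lei_trans x y z : lei inc x y -> lei inc y z -> lei inc x z.
  by move=> /asboolP xy /asboolP yz; apply/asboolP; exact: spec_trans xy yz.
have lei_anti x y : lei inc x y -> lei inc y x -> x = y.
  move=> xy yx; apply/eqP; apply/negPn/negP => nxy.
  have [c _ []] := irred _ _ nxy (or_introl xy); split=> h.
    exact: lei_trans h yx.
  exact: lei_trans xy h.
pose lt x y := (x != y) && lei inc x y.
have lt_irr : irreflexive lt by move=> x; rewrite /lt eqxx.
have lt_trans : transitive lt.
  move=> y x z /andP[xy lxy] /andP[yz lyz]; rewrite /lt (lei_trans _ _ _ lxy lyz) andbT.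
  by apply/eqP => xz; subst z; move/eqP: xy; apply; exact: lei_anti.
have geE x y : rge lt x y = lei inc y x.
  by rewrite /rge /rgt /lt eq_sym; case: eqVneq => [->|//] /=; symmetry; apply/asboolP.
have ac : acyclic lt.
  apply: (weakly_contractible_acyclic lt_irr lt_trans htX incK).
    by move=> x y U oU /andP[_ /asboolP xy] Uy; exact: xy.
  move=> x; have -> : [set q | rge lt x (ret q)] = (inc \o ret) @^-1` [set p | specializes p (inc x)].
    by apply/seteqP; split=> q /=; rewrite geE => /asboolP.
  by move/continuousP: cir; apply; exact: min_open.
have no_up a b : lt a b -> exists c, [/\ lt a c, c != b & ~~ lt b c].
  move=> /andP[ab lab]; rewrite eq_sym in ab.
  have [c ca /not_andP nc] := irred b a ab (or_intror lab).
  (* The implication for points below holds by transitivity, so [c] refutes the other one. *)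
  have {}nc : ~ (lei inc a c -> lei inc b c).
    case: nc => // nc h; apply: nc => lca; exact: lei_trans lca lab.
  move/not_implyP: nc => [ac' /negP nbc]; exists c; rewrite /lt ac' andbT eq_sym ca; split=> //.
    by apply: contraNneq nbc => ->; apply/asboolP.
  by rewrite (negPf nbc) andbF.
have no_down a b : lt b a -> exists c, [/\ lt c a, c != b & ~~ lt c b].
  move=> /andP[ab lab].
  have [c ca /not_andP nc] := irred b a ab (or_introl lab).
  have {}nc : ~ (lei inc c a -> lei inc c b).
    case: nc => // nc h; apply: nc => lca; exact: lei_trans lab lca.
  move/not_implyP: nc => [ac' /negP nbc]; exists c; rewrite /lt ac' andbT ca; split=> //.
    by apply: contraNneq nbc => ->; apply/asboolP.
  by rewrite (negPf nbc) andbF.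
have m_gt1 : (1 < m)%N.
  rewrite ltnNge; apply/negP => m_le1.
  have [[q _] _ _] := htX; move: m_le1; rewrite leq_eqVlt ltnS leqn0 => /orP[/eqP m1|/eqP m0].
    by apply: ncX; subst m; exact: retract1_contractible hr.
  by have := ltn_ord (ret q); rewrite [X in (_ < X)%N]m0.
have m_le9 : (m <= 9)%N by exact: leq_trans k9.
pose x0 : 'I_m := Ordinal (ltnW m_gt1).
have [] := minimal_acyclic_poset lt_irr lt_trans ac no_up no_down _ _ x0; rewrite ?card_ord //.
move=> m9 [p [up sp hp]].
have k_eq : k = 9%N by apply/eqP; rewrite eqn_leq k9 -m9.
split=> //; exists (fun i => inc (nth x0 p i)); split=> [q|].
  have mem_p x : x \in p.
    have [|_ ->] := uniq_min_size up (fun y _ => mem_enum 'I_m y); last by rewrite mem_enum.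
    by rewrite size_enum_ord sp m9.
  (* An injection between sets of nine elements is onto, so the core is the whole of [X]. *)
  have /choice[g gK] : forall x, exists i, e i = inc x by move=> x; exact: e_surj.
  have gI : injective g by move=> x y /(congr1 e); rewrite !gK => /incI.
  have [j ej] := e_surj q.
  have [g' _ gg'] : bijective g by apply: inj_card_bij => //; rewrite !card_ord m9 k_eq.
  exists (index (g' j) p); first by rewrite -sp index_mem.
  by rewrite nth_index // -gK gg'.
have specE i j : (i < 9)%N -> (j < 9)%N ->
    specializes (inc (nth x0 p i)) (inc (nth x0 p j)) <-> (i == j) || lt (nth x0 p i) (nth x0 p j).
  move=> hi hj; rewrite /lt nth_uniq ?sp //.
  split=> [/asboolP sij|]; first by rewrite /lei sij andbT orbN.
  by case: eqVneq => [-> _ U|_ /asboolP].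
case: hp => hp; [left|right] => i j hi hj.
  by rewrite -hp //; exact: specE.
by rewrite eq_sym -hp //; exact: specE.
Qed.

End FiniteSpace.

(* From the order to the homeomorphism *)
Local Close Scope ring_scope.
Local Open Scope card_scope.

(** The matrix already contains the transitive closure; with three levels, two covers reach every
    related pair, so finite checks suffice. *)
Lemma P_leE x y : P_le x y = (P_code x == P_code y) || P_lt_code (P_code x) (P_code y).
Proof.
pose le x y := (P_code x == P_code y) || P_lt_code (P_code x) (P_code y).
apply/idP/idP => [/connectP[s]|].
  have step u v w : P_cover u v -> le v w -> le u w.
    have: all (fun u => all (fun v => all (fun w => P_cover u v ==> le v w ==> le u w)
      P_enum) P_enum) P_enum by vm_compute.
    have mem t : t \in P_enum by case: t.
    by move=> /allP/(_ u (mem u))/allP/(_ v (mem v))/allP/(_ w (mem w))/implyP h /h/implyP.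
  elim: s x => [|z s IH] x /=; first by move=> _ ->; rewrite eqxx.
  by move=> /andP[xz zs] yE; exact: step xz (IH z zs yE).
have : (P_code x == P_code y) || P_lt_code (P_code x) (P_code y) ->
    [|| P_code x == P_code y, P_cover x y | has (fun z => P_cover x z && P_cover z y) P_enum].
  by case: x; case: y.
move=> h /h /or3P[/eqP/(can_inj P_codeK) ->|xy|/hasP[z _ /andP[xz zy]]].
- exact: connect0.
- exact: connect1.
- exact: connect_trans (connect1 xz) (connect1 zy).
Qed.

(** Open sets of a finite space are its down-sets, so order isomorphisms are homeomorphisms. *)
Lemma homeomorphic_of_spec d (T : finPOrderType d) (X : topologicalType) (k : nat)
    (e : 'I_k -> X) (u : T -> X) :
  (forall q, exists i, e i = q) -> (forall q, exists x, u x = q) -> injective u ->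
  (forall x y, specializes (u x) (u y) <-> (x <= y)%O) -> homeomorphic X (poset_space T).
Proof.
move=> es us ui hu; have /choice[g gK] := us.
have uK : cancel u g by move=> x; apply: ui; rewrite gK.
exists g, u; split=> //; apply/continuousP => U.
  rewrite poset_space_openE => dU; apply: (down_open es) => p q pq /=.
  by apply: dU; apply/hu; rewrite !gK.
by move=> oU; rewrite poset_space_openE => x y /hu xy; exact: xy.
Qed.

Theorem theorem3p7 (R : realType) (X : topologicalType) :
  homotopically_trivial R X -> ~ contractible R X -> [set: X] #= `I_9 ->
  homeomorphic X P \/ homeomorphic X Pop.
Proof.
move=> htX ncX /card_set_bijP[f [f9 fI fS]].
have /choice[e fe] : forall i : 'I_9, exists q, f q = i.
  by move=> i; have [q _ fq] := fS i (ltn_ord i); exists q.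
have es q : exists i, e i = q.
  have q9 : (f q < 9)%N by exact: (f9 q I).
  by exists (Ordinal q9); apply: fI; rewrite ?inE // fe.
have ei : injective e by move=> i j /(congr1 f); rewrite !fe => /val_inj.
have [_ [v [vs hv]]] := core_poset es ei (leqnn 9) htX ncX.
pose u (x : P_pt) := v (P_code x).
have c9 x : (P_code x < 9)%N by case: x.
have us q : exists x, u x = q.
  have [i i9 <-] := vs q; exists (nth a1 P_enum i).
  by rewrite /u; congr v; move: i i9; do 9! case=> //.
case: hv => hv; [left|right].
  have hu x y : specializes (u x) (u y) <-> (x <= y)%O.
    by rewrite -[(x <= y)%O]/(P_le x y) P_leE; exact: hv.
  apply: (homeomorphic_of_spec es us _ hu) => x y uxy.
  by apply/le_anti/andP; split; apply/hu; rewrite uxy.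
have hu (x y : P_pt^d) : specializes (u x) (u y) <-> (x <= y)%O.
  by rewrite -[(x <= y)%O]/(P_le y x) P_leE; exact: hv.
apply: (homeomorphic_of_spec (T := P_pt^d) es us _ hu) => x y uxy.
by apply: (le_anti (T := P_pt^d)); apply/andP; split; apply/hu; rewrite uxy.
Qed.
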